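(* Let $A$ be a finite-dimensional unimodular ribbon Hopf algebra over a field $k$. The set $\mathcal T\subset\hat Z^S(A)$ is a commutative monoid with respect to the usual product and also with respect to the $\star$-product on $\hat Z^S(A)$. Moreover, $\hat J$ sends $\mathcal T$ into itself.
   Context: $A=(A,m,\Delta,S,\epsilon,e)$ is a finite-dimensional Hopf algebra over a field $k$; Sweedler notation $\Delta(a)=\sum a_{(1)}\otimes a_{(2)}$. It is quasitriangular with $R$-matrix $R=\sum_i\alpha_i\otimes\beta_i$ (invertible, $T\Delta(a)=R\Delta(a)R^{-1}$ with $T$ the flip, $(\Delta\otimes1)R=R^{13}R^{23}$, $(1\otimes\Delta)R=R^{13}R^{12}$). Ribbon: $A$ is endowed with an invertible group-like element $g$ ($\Delta(g)=g\otimes g$) such that $S^2(a)=gag^{-1}$ for all $a$, and, with $u=\sum_i S(\beta_i)\alpha_i$, the central ribbon element $\theta=gu^{-1}=u^{-1}g$ satisfies $S(\theta)=\theta$. Unimodular: left and right integrals of $A$ coincide. $\Lambda\in A$ is an integral ($a\Lambda=\Lambda a=\epsilon(a)\Lambda$) and $\lambda\in A^*$ is a right integral for $A^*$ ($\sum\lambda(a_{(1)})a_{(2)}=\lambda(a)1$), with $\lambda(\Lambda)=1$. $a\star b=\sum_b\lambda(S(a)b_{(1)})b_{(2)}$. $Z(A)$ is the center; $K(A)=\{a\in Z(A)\mid\lambda(ab)=0\text{ for all }b\in Z(A)\}$; $\hat Z(A)=Z(A)/K(A)$; $[a]$ is the class of $a$; $\hat Z^S(A)=\{[a]\mid[S(a)]=[a]\}$.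 The usual product and $\star$ (with unit $[\Lambda]$) descend to $\hat Z(A)$. $J(z)=\sum_{i,j}\lambda(z\beta_i\alpha_j)\alpha_i\beta_j$ maps $Z(A)$ to itself and induces $\hat J:\hat Z(A)\to\hat Z(A)$, $\hat J([z])=[J(z)]$. $C^2=\{x\in A\otimes A\mid\Delta(b)x=x\Delta(b)\ \forall b\in A\}$; $C^2_Z\subset C^2$ is the commutative subalgebra generated by the elements $(a\otimes b)\Delta(c)$, $a,b,c\in Z(A)$. With $\mu(\sum_i a_i\otimes b_i,\sum_j c_j\otimes d_j)=\sum_{i,j}\lambda(a_ic_j)\lambda(b_id_j)$, put $K^2_Z=\{x\in C^2_Z\mid\mu(x,y)=0\text{ for all }y\in C^2\}$. The map $\delta(w,z)=z\otimes w-(1\otimes w)\Delta(z)\in C^2_Z$ induces $\hat\delta:\hat Z(A)\otimes\hat Z(A)\to C^2_Z/K^2_Z$. Finally $\mathcal T=\{[z]\in\hat Z^S(A)\mid\hat\delta([z],[z])=0\}$. *)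

(* Defs.v *)
From HB Require Import structures.
From mathcomp Require Import all_boot all_order all_algebra all_field.

Set Implicit Arguments.
Unset Strict Implicit.
Unset Printing Implicit Defensive.

Import GRing.Theory.
Import Quotient.Exports.
Local Open Scope ring_scope.
Local Open Scope quotient_scope.

(* Tensor product of finite-dimensional vector spaces: x : U \ox V is the matrix
   of its coordinates in the basis e_i \ox e_j attached to the chosen bases of
   U and V. The choice is immaterial: for bilinear f, \tsum_(a, b <- x) f a b is
   the value at x of the linear map induced by f (tsum_is_linear, tsumE), that
   is, \sum_i f a_i b_i for any decomposition x = \sum_i a_i \ox b_i. *)
Definition tens (k : fieldType) (U V : vectType k) : Type :=
  'M[k]_(\dim {:U}, \dim {:V}).
HB.instance Definition _ (k : fieldType) (U V : vectType k) :=
  Vector.on (tens U V).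

Arguments tens {k} (U V)%_type_scope.
Notation "U '\ox' V" := (tens U V) (at level 40, left associativity) : type_scope.

Section Tensor.
Variables (k : fieldType) (U V : vectType k).

Definition tprod (u : U) (v : V) : U \ox V :=
  \matrix_(i, j) (coord (vbasis {:U}) i u * coord (vbasis {:V}) j v).

Definition tsum (W : lmodType k) (f : U -> V -> W) (x : U \ox V) : W :=
  \sum_i \sum_j (x : 'M_(_, _)) i j *: f (vbasis {:U})`_i (vbasis {:V})`_j.

End Tensor.

Notation "u '\ox' v" := (tprod u v) (at level 40, left associativity) : ring_scope.
Notation "\tsum_ ( a , b <- x ) E" := (tsum (fun a b => E) x)
  (at level 41, a name, b name, x at level 100, E at level 41,
   format "\tsum_ ( a ,  b  <-  x )  E") : ring_scope.

Section TensorTheory.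
Variables (k : fieldType) (U V : vectType k).
Implicit Types (W : lmodType k).

Definition bilin W (f : U -> V -> W) :=
  (forall v, linear (f^~ v)) /\ (forall u, linear (f u)).

Lemma linear_scale W1 W2 (f : W1 -> W2) : linear f -> forall a, {morph f : x / a *: x}.
Proof. exact: scalable_linear. Qed.

Lemma linear_sumZ W1 W2 (f : W1 -> W2) (I : finType) (c : I -> k) (e : I -> W1) :
  linear f -> f (\sum_i c i *: e i) = \sum_i c i *: f (e i).
Proof.
move=> fL; pose g : {linear W1 -> W2} :=
  HB.pack f (GRing.isLinear.Build k W1 W2 _ f fL).
rewrite -[f]/(g : _ -> _) linear_sum; apply: eq_bigr => i _.
exact: linearZ.
Qed.

Lemma tprod_bilin : bilin (@tprod k U V).
Proof.
split=> [v a u1 u2|u a v1 v2]; apply/matrixP=> i j; rewrite !mxE linearP /=.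
  by rewrite mulrDl mulrA.
by rewrite mulrDr mulrCA.
Qed.

Lemma tsum_is_linear W (f : U -> V -> W) : linear (tsum f).
Proof.
move=> a x y; rewrite /tsum scaler_sumr -big_split; apply: eq_bigr => i _ /=.
rewrite scaler_sumr -big_split; apply: eq_bigr => j _ /=.
by rewrite !mxE scalerDl scalerA.
Qed.

Lemma tsum_linf W1 W2 (f : W1 -> U -> V -> W2) (x : U \ox V) :
  (forall u v, linear (fun w => f w u v)) -> linear (fun w => \tsum_(a, b <- x) f w a b).
Proof.
move=> fL c w1 w2; rewrite /tsum scaler_sumr -big_split; apply: eq_bigr => i _ /=.
rewrite scaler_sumr -big_split; apply: eq_bigr => j _ /=.
by rewrite fL scalerDr !scalerA mulrC.
Qed.

Lemma tsumE W (f : U -> V -> W) u v : bilin f -> \tsum_(a, b <- u \ox v) f a b = f u v.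
Proof.
case=> fl fr; rewrite {2}(coord_vbasis (memvf u)) (linear_sumZ _ _ (fl v)).
apply: eq_bigr => i _.
rewrite {2}(coord_vbasis (memvf v)) (linear_sumZ _ _ (fr _)) scaler_sumr.
by apply: eq_bigr => j _; rewrite mxE scalerA.
Qed.

Lemma tens_sum (x : U \ox V) : \tsum_(a, b <- x) (a \ox b) = x.
Proof.
have e (W' : vectType k) i (j : 'I_(\dim {:W'})) : coord (vbasis {:W'}) i (vbasis {:W'})`_j
    = (j == i)%:R :> k by apply: coord_free; exact: basis_free (vbasisP _).
apply/matrixP=> i j; rewrite /tsum summxE (bigD1 i) //= summxE (bigD1 j) //=.
rewrite !mxE !e !eqxx !mulr1 !big1 ?addr0 // => [i' ni|j' nj].
  by rewrite summxE big1 // => j' _; rewrite !mxE !e (negbTE ni) mul0r mulr0.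
by rewrite !mxE !e (negbTE nj) !mulr0.
Qed.

Lemma tens_ext W (f g : U \ox V -> W) :
  linear f -> linear g -> (forall u v, f (u \ox v) = g (u \ox v)) -> f =1 g.
Proof.
move=> fL gL fg x.
have E h : linear h -> h x = \tsum_(a, b <- x) h (a \ox b) :> W.
  move=> hL; rewrite -{1}[x]tens_sum /tsum.
  under eq_bigr do rewrite -[\sum_j _]scale1r.
  rewrite linear_sumZ //; apply: eq_bigr => i _.
  by rewrite scale1r linear_sumZ.
rewrite (E f fL) (E g gL).
by apply: eq_bigr => i _; apply: eq_bigr => j _; rewrite fg.
Qed.

End TensorTheory.

Section TensorAlgebra.
Variables (k : fieldType) (A B : falgType k).
Implicit Types x y z : A \ox B.

Definition tmul x y : A \ox B :=
  \tsum_(a, b <- x) \tsum_(c, d <- y) ((a * c) \ox (b * d)).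
Definition tone : A \ox B := 1 \ox 1.

Let prodl (v : B) : linear (fun u : A => u \ox v). Proof. by case: (tprod_bilin A B). Qed.
Let prodr (u : A) : linear (fun v : B => u \ox v). Proof. by case: (tprod_bilin A B). Qed.

Fact tmul_bilin : bilin tmul.
Proof.
split=> [y|x]; first by move=> a x1 x2; rewrite /tmul tsum_is_linear.
by apply: tsum_linf => u v c y1 y2; rewrite tsum_is_linear.
Qed.

Let mull y : linear (tmul^~ y). Proof. by case: tmul_bilin. Qed.
Let mulr x : linear (tmul x). Proof. by case: tmul_bilin. Qed.

Fact tmulE a b c d : tmul (a \ox b) (c \ox d) = (a * c) \ox (b * d).
Proof.
rewrite /tmul tsumE ?tsumE //.
  by split=> u t v w; rewrite mulrDr -scalerAr ?prodl ?prodr.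
by split=> u; apply: tsum_linf => v w t x y;
  rewrite mulrDl -scalerAl ?prodl ?prodr.
Qed.

Let idL : linear (fun x : A \ox B => x). Proof. by []. Qed.
Let compL (f g : A \ox B -> A \ox B) : linear f -> linear g -> linear (fun x => f (g x)).
Proof. by move=> fL gL a x y; rewrite gL fL. Qed.

Fact tmulA : associative tmul.
Proof.
move=> x y z; move: x; apply: tens_ext => [||a1 a2].
- exact: mull.
- exact: (compL (mull z) (mull y)).
move: y; apply: tens_ext => [||b1 b2].
- exact: (compL (mulr _) (mull z)).
- exact: (compL (mull z) (mulr _)).
move: z; apply: tens_ext => [||c1 c2].
- exact: (compL (mulr _) (mulr _)).
- exact: mulr.
by rewrite !tmulE !mulrA.
Qed.

Fact tmul1 : left_id tone tmul.
Proof.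
by apply: tens_ext => [||a b]; [exact: mulr | exact: idL | rewrite tmulE !mul1r].
Qed.

Fact tmulr1 : right_id tone tmul.
Proof.
by apply: tens_ext => [||a b]; [exact: mull | exact: idL | rewrite tmulE !mulr1].
Qed.

Fact tmulDl : left_distributive tmul +%R.
Proof. by move=> x y z; rewrite -[x in LHS]scale1r mull scale1r. Qed.

Fact tmulDr : right_distributive tmul +%R.
Proof. by move=> x y z; rewrite -[y in LHS]scale1r mulr scale1r. Qed.

Fact tone_neq0 : tone != 0.
Proof.
have coord1 (C : falgType k) : exists i, coord (vbasis {:C}) i 1 != 0.
  apply/existsP; rewrite -negb_forall; apply/forallP => c0.
  have /eqP[] := oner_neq0 C; rewrite [LHS](coord_vbasis (memvf (1 : C))).
  by rewrite big1 // => i _; rewrite (eqP (c0 i)) scale0r.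
have [i ni] := coord1 A; have [j nj] := coord1 B.
apply/eqP => /matrixP/(_ i j); rewrite !mxE => /eqP.
by rewrite mulf_eq0 (negbTE ni) (negbTE nj).
Qed.

HB.instance Definition _ := GRing.Zmodule_isNzRing.Build (A \ox B)%type
  tmulA tmul1 tmulr1 tmulDl tmulDr tone_neq0.

Fact tscaleAl (a : k) x y : a *: (x * y) = a *: x * y.
Proof. exact/esym/(linear_scale (mull y)). Qed.
HB.instance Definition _ := GRing.Lmodule_isLalgebra.Build k (A \ox B)%type tscaleAl.

Fact tscaleAr (a : k) x y : a *: (x * y) = x * (a *: y).
Proof. exact/esym/(linear_scale (mulr x)). Qed.
HB.instance Definition _ := GRing.Lalgebra_isAlgebra.Build k (A \ox B)%type tscaleAr.
HB.instance Definition _ := Algebra_isFalgebra.Build k (A \ox B)%type.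

Lemma tprodM (a c : A) (b d : B) : (a \ox b) * (c \ox d) = (a * c) \ox (b * d).
Proof. exact: tmulE. Qed.
Lemma tprod1 : (1 : A) \ox (1 : B) = 1.
Proof. by []. Qed.
End TensorAlgebra.

Section Radical.
Variables (k : fieldType) (vT : vectType k).

(* The vectors of U orthogonal to all of V for the bilinear form beta. *)
Definition orthov (beta : vT -> vT -> k^o) (U V : {vspace vT}) : {vspace vT} :=
  (U :&: \bigcap_(v <- vbasis V) lker (linfun (beta^~ v)))%VS.

Lemma orthovP (beta : vT -> vT -> k^o) (U V : {vspace vT}) u : bilin beta ->
  reflect (u \in U /\ {in V, forall v, beta u v = 0}) (u \in orthov beta U V).
Proof.
case=> bl br; rewrite memv_cap.
have E v w : linfun (beta^~ v) w = beta w v.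
  pose g : {linear vT -> k^o} :=
    HB.pack (beta^~ v) (GRing.isLinear.Build k vT k^o _ (beta^~ v) (bl v)).
  exact: (lfunE g).
have -> : (u \in \bigcap_(v <- vbasis V) lker (linfun (beta^~ v)))%VS =
    all (fun v => beta u v == 0) (vbasis V).
  elim: (tval (vbasis V)) => [|v s IHs]; first by rewrite big_nil memvf.
  by rewrite big_cons memv_cap IHs memv_ker E.
apply: (iffP andP) => -[Uu b0]; split=> //.
  move=> v Vv; rewrite (coord_vbasis Vv) (linear_sumZ _ _ (br u)) big1 // => i _.
  by rewrite (eqP (allP b0 _ (mem_nth 0 _))) ?scaler0 // size_tuple.
by apply/allP => v /vbasis_mem/b0 ->.
Qed.

End Radical.

Section VectorQuotient.
Variables (k : fieldType) (vT : vectType k).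
Implicit Types U V : {vspace vT}.

(* The quotient U / V of nested subspaces V <= U. *)
Definition vquot U V : Type := 
  Quotient.quot (pred_of_vspace (linfun (@vsval k vT U) @^-1: V) : zmodClosed (subvs_of U)).
HB.instance Definition _ U V := GRing.Zmodule.on (vquot U V).
HB.instance Definition _ U V := EqQuotient.on (vquot U V).

(* Meaningful for u \in U only. *)
Definition vclass U V (u : vT) : vquot U V := \pi_(vquot U V) (vsproj U u).
Definition vrepr U V (x : vquot U V) : vT := vsval (repr x).

Lemma vrepr_mem U V (x : vquot U V) : vrepr x \in U.
Proof. exact: subvsP. Qed.

Lemma vreprK U V : cancel (@vrepr U V) (vclass U V).
Proof. by move=> x; rewrite /vclass /vrepr vsvalK reprK. Qed.

Lemma eq_vclass U V u v : u \in U -> v \in U ->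
  (vclass U V u == vclass U V v) = (u - v \in V).
Proof.
by move=> Uu Uv; rewrite -Quotient.idealrBE -memv_preim lfunE /= !vsprojK.
Qed.

End VectorQuotient.

Section Induced.
Variables (k : fieldType) (vT wT : vectType k).
Variables (U V : {vspace vT}) (U' V' : {vspace wT}).

(* The maps induced by f on quotients. They are defined through representatives
   so as to be total; [f] [u] = [f u], resp. [f] [u] [v] = [f u v], whenever f
   maps U to U' and respects congruence modulo V and V' (vmap1E, vmap2E). *)
Definition vmap1 (f : vT -> wT) (x : vquot U V) : vquot U' V' :=
  vclass U' V' (f (vrepr x)).

Definition vmap2 (f : vT -> vT -> wT) (x y : vquot U V) : vquot U' V' :=
  vclass U' V' (f (vrepr x) (vrepr y)).

Lemma vrepr_class u : u \in U -> vrepr (vclass U V u) - u \in V.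
Proof. by move=> Uu; rewrite -(@eq_vclass _ _ U) ?vrepr_mem // vreprK. Qed.

Lemma vmap1E f u : {in U, forall v, f v \in U'} ->
    {in U &, forall v w, v - w \in V -> f v - f w \in V'} ->
  u \in U -> vmap1 f (vclass U V u) = vclass U' V' (f u).
Proof.
move=> fU fV Uu; apply/eqP; rewrite eq_vclass ?fU ?vrepr_mem //.
by rewrite fV ?vrepr_mem ?vrepr_class.
Qed.

Lemma vmap2E f u v : {in U &, forall u v, f u v \in U'} ->
    {in U & &, forall u v w, u - v \in V -> f u w - f v w \in V'} ->
    {in U & &, forall u v w, u - v \in V -> f w u - f w v \in V'} ->
  u \in U -> v \in U -> vmap2 f (vclass U V u) (vclass U V v) = vclass U' V' (f u v).
Proof.
move=> fU fVl fVr Uu Uv; apply/eqP; rewrite eq_vclass ?fU ?vrepr_mem //.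
rewrite -(subrKA (f u (vrepr (vclass U V v)))).
by rewrite rpredD ?fVl ?fVr ?vrepr_mem ?vrepr_class.
Qed.

End Induced.
Arguments vmap1 {k vT wT U V U' V'} f x.
Arguments vmap2 {k vT wT U V U' V'} f x y.

Record hopfAlgebra (k : fieldType) (A : falgType k) := HopfAlgebra {
  comul : 'AHom(A, (A \ox A)%type);
  counit : 'AHom(A, k^o);
  antipode : 'End(A);
  comulA : forall a, \tsum_(b, c <- comul a) (comul b \ox c) =
    \tsum_(b, c <- comul a) \tsum_(d, e <- comul c) ((b \ox d) \ox e);
  counitl : forall a, \tsum_(b, c <- comul a) (counit b *: c) = a;
  counitr : forall a, \tsum_(b, c <- comul a) (counit c *: b) = a;
  antipodel : forall a, \tsum_(b, c <- comul a) (antipode b * c) = (counit a)%:A;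
  antipoder : forall a, \tsum_(b, c <- comul a) (b * antipode c) = (counit a)%:A
}.

Section RibbonHopf.
Variables (k : fieldType) (A : falgType k).

Definition tflip (x : A \ox A) : A \ox A := \tsum_(a, b <- x) (b \ox a).

Definition leg12 (x : A \ox A) : A \ox A \ox A := x \ox 1.
Definition leg13 (x : A \ox A) : A \ox A \ox A :=
  \tsum_(a, b <- x) ((a \ox 1) \ox b).
Definition leg23 (x : A \ox A) : A \ox A \ox A :=
  \tsum_(a, b <- x) ((1 \ox a) \ox b).

Definition is_Rmatrix (H : hopfAlgebra A) (R : A \ox A) :=
  [/\ R \is a GRing.unit,
      forall a, tflip (comul H a) = R * comul H a * R^-1,
      \tsum_(a, b <- R) (comul H a \ox b) = leg13 R * leg23 R &
      \tsum_(a, b <- R) \tsum_(c, d <- comul H b) ((a \ox c) \ox d) =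
        leg13 R * leg12 R].

Definition uelt (H : hopfAlgebra A) (R : A \ox A) : A :=
  \tsum_(a, b <- R) (antipode H b * a).

Record ribbonHopfAlgebra := RibbonHopfAlgebra {
  hopf :> hopfAlgebra A;
  Rmx : A \ox A;
  RmxP : is_Rmatrix hopf Rmx;
  pivot : A;
  pivot_unit : pivot \is a GRing.unit;
  pivot_grouplike : comul hopf pivot = pivot \ox pivot;
  antipode_sqr : forall a, antipode hopf (antipode hopf a) = pivot * a * pivot^-1;
  (* u is invertible with u a u^-1 = S^2(a) for any R-matrix, hence this
     element is central and also equal to u^-1 * pivot. *)
  ribbon_elt := pivot * (uelt hopf Rmx)^-1;
  ribbon_antipode : antipode hopf ribbon_elt = ribbon_elt
}.

End RibbonHopf.

Section Integrals.
Variables (k : fieldType) (A : falgType k) (H : hopfAlgebra A).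
Implicit Types (L : A) (lam : 'Hom(A, k^o)).

Definition left_integral L := forall a, a * L = counit H a *: L.
Definition right_integral L := forall a, L * a = counit H a *: L.

Definition unimodular := forall L, left_integral L <-> right_integral L.

Definition two_sided_integral L := left_integral L /\ right_integral L.

Definition dual_right_integral lam :=
  forall a, \tsum_(b, c <- comul H a) (lam b *: c) = (lam a)%:A.

End Integrals.

Section Center.
Variables (k : fieldType) (A : falgType k) (H : ribbonHopfAlgebra A).
Variable lam : 'Hom(A, k^o).

Local Notation S := (antipode H).
Local Notation Delta := (comul H).
Local Notation Z := ('Z({:A}))%VS.

(* Delta b = \sum c \ox d stands for the Sweedler sum b_(1) \ox b_(2). *)
Definition star (a b : A) : A :=
  \tsum_(c, d <- Delta b) (lam (S a * c) *: d).

Definition Jmap (z : A) : A :=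
  \tsum_(a, b <- Rmx H) \tsum_(c, d <- Rmx H) (lam (z * b * c) *: (a * d)).

Definition trform (a b : A) : k^o := lam (a * b).

Fact trform_bilin : bilin trform.
Proof.
split=> [v a x y|v a x y]; rewrite /trform; first by rewrite mulrDl -scalerAl linearP.
by rewrite mulrDr -scalerAr linearP.
Qed.

Definition KA : {vspace A} := orthov trform Z Z.
Lemma memKA a : reflect (a \in Z /\ {in Z, forall b, lam (a * b) = 0}) (a \in KA).
Proof. exact: orthovP trform_bilin. Qed.

Definition hatZ : Type := vquot Z KA.
Definition hatcl (a : A) : hatZ := vclass Z KA a.

Definition hatmul : hatZ -> hatZ -> hatZ := vmap2 *%R.
Lemma hatmulE a b : a \in Z -> b \in Z -> hatmul (hatcl a) (hatcl b) = hatcl (a * b).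
Proof.
have ZM : {in Z &, forall u v, u * v \in Z}.
  move=> u v; rewrite !memv_cap !memvf /= => /centvP uC /centvP vC.
  by apply/centvP => w _; rewrite -mulrA vC ?memvf // mulrA uC ?memvf // mulrA.
have ZC u v : u \in Z -> u * v = v * u.
  by rewrite memv_cap => /andP[_ /centvP]; apply; rewrite memvf.
apply: vmap2E => // u v w Zu Zv Zw /memKA[Zuv uv0]; rewrite -(mulrBl, mulrBr).
  apply/memKA; split=> [|t Zt]; first exact: ZM.
  by rewrite -mulrA uv0 // ZM.
apply/memKA; split=> [|t Zt]; first exact: ZM.
by rewrite (ZC w) // -mulrA uv0 // ZM.
Qed.

Definition hatstar : hatZ -> hatZ -> hatZ := vmap2 star.
Definition hatS : hatZ -> hatZ := vmap1 S.
Definition hatJ : hatZ -> hatZ := vmap1 Jmap.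
Definition hatZS : {pred hatZ} := [pred x | hatS x == x].

Definition C2 : {vspace (A \ox A)%type} := 'C(limg Delta)%VS.

Lemma memC2 x : reflect (forall b, Delta b * x = x * Delta b) (x \in C2).
Proof.
rewrite /C2; apply: (iffP centvP) => [xC b|xC y /memv_imgP[b _ ->]]; last by rewrite xC.
by rewrite xC // memv_img ?memvf.
Qed.

Definition tensv (U V : {vspace A}) : {vspace (A \ox A)%type} :=
  <<[seq a \ox b | a <- vbasis U, b <- vbasis V]>>%VS.

(* agenv X is the unital subalgebra generated by X; C2Z is the smallest
   subalgebra containing the (a \ox b) * Delta c for a, b, c in the center
   (memC2Z, C2Z_sub). *)
Definition C2Z : {vspace (A \ox A)%type} := agenv (tensv Z Z * (Delta @: Z)).

Lemma mem_tensv (U V : {vspace A}) a b : a \in U -> b \in V -> a \ox b \in tensv U V.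
Proof.
have [prl prr] := tprod_bilin A A.
move=> Ua Vb; rewrite (coord_vbasis Ua) (linear_sumZ _ _ (prl _)).
apply: memv_suml => i _; apply: memvZ.
rewrite (coord_vbasis Vb) (linear_sumZ _ _ (prr _)).
apply: memv_suml => j _; apply/memvZ/memv_span/allpairs_f;
  by apply: mem_nth; rewrite size_tuple.
Qed.

Lemma memC2Z a b c : a \in Z -> b \in Z -> c \in Z -> (a \ox b) * Delta c \in C2Z.
Proof.
move=> Za Zb Zc; apply: (subvP (sub_agenv _)).
by rewrite memv_mul ?mem_tensv ?memv_img.
Qed.

Lemma C2Z_sub (B : {aspace (A \ox A)}) : 1 \in B ->
    (forall a b c, a \in Z -> b \in Z -> c \in Z -> (a \ox b) * Delta c \in B) ->
  (C2Z <= B)%VS.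
Proof.
move=> B1 BZ; apply: agenv_sub_modl; first by rewrite -memvE.
apply: prodv_sub => //; apply/prodvP => x y Zx /memv_imgP[c Zc ->].
suff /subvP/(_ _ Zx) : (tensv Z Z <= amulr (Delta c) @^-1: B)%VS.
  by rewrite -memv_preim lfunE.
apply/span_subvP => _ /allpairsP[[a b] /= [/vbasis_mem Za /vbasis_mem Zb ->]].
by rewrite -memv_preim lfunE; exact: (BZ _ _ _ Za Zb Zc).
Qed.

Definition muform (x y : (A \ox A)%type) : k^o :=
  \tsum_(a, b <- x) \tsum_(c, d <- y) (lam (a * c) * lam (b * d)).

Fact muform_bilin : bilin muform.
Proof.
split=> [y|x]; first by move=> c x1 x2; rewrite /muform tsum_is_linear.
by apply: tsum_linf => a b c y1 y2; rewrite tsum_is_linear.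
Qed.

Lemma muformE a b c d : muform (a \ox b) (c \ox d) = lam (a * c) * lam (b * d).
Proof.
rewrite /muform tsumE ?tsumE //.
  split=> u t x y; first by rewrite mulrDr -scalerAr linearP mulrDl -scalerAl.
  by rewrite mulrDr -scalerAr linearP mulrDr -scalerAr.
split=> u; apply: tsum_linf => v w t x y.
  by rewrite mulrDl -scalerAl linearP mulrDl -scalerAl.
by rewrite mulrDl -scalerAl linearP mulrDr -scalerAr.
Qed.

Definition K2Z : {vspace (A \ox A)%type} := orthov muform C2Z C2.

Lemma memK2Z x :
  reflect (x \in C2Z /\ {in C2, forall y, muform x y = 0}) (x \in K2Z).
Proof. exact: orthovP muform_bilin. Qed.

Definition delta (w z : A) : A \ox A := z \ox w - (1 \ox w) * Delta z.

Lemma delta_mem w z : w \in Z -> z \in Z -> delta w z \in C2Z.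
Proof.
have Z1 : 1 \in Z by rewrite memv_cap memvf centv1.
move=> Zw Zz; rewrite rpredB ?memC2Z //.
by have := memC2Z Zz Zw Z1; rewrite rmorph1 mulr1.
Qed.

(* As a bilinear map on hatZ x hatZ rather than a linear map on the tensor
   square of hatZ. *)
Definition hatdelta : hatZ -> hatZ -> vquot C2Z K2Z := vmap2 delta.

Definition calT : {pred hatZ} := [pred x in hatZS | hatdelta x x == 0].

End Center.
Arguments hatcl {k A} lam a.
Arguments hatmul {k A} lam x y : rename.
Arguments hatstar {k A} H lam x y : rename.
Arguments hatJ {k A} H lam x : rename.
Arguments calT {k A} H lam.

Definition comm_monoid_on (T : Type) (M : {pred T}) (op : T -> T -> T) (e : T) :=
  [/\ e \in M, {in M &, forall x y, op x y \in M}, {in M & &, associative op},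
      {in M &, commutative op} & {in M, left_id e op}].

(* Main.v *)
(* For t in the centralizer C2 of Delta(A), write F = lam (x) lam and
   Q(t) = t' * t'', E(t) = lam(t') t'', where * is the star product. Since * is a
   morphism of A-bimodules A (x) A -> A and is dual to Delta under lam, both Q(t)
   and E(t) are central, with F(Delta(a) t) = lam(a Q(t)) and
   F((1 (x) a) t) = lam(a E(t)). Moreover F is invariant on C2 under
   conjugation by R followed by the flip. Hence lam o S = lam on the center, F is
   also invariant under S (x) S on C2, all maps descend to the quotient by the
   radical, and a central z whose class is fixed by S represents an element of T
   iff it can be slid: F((z (x) z) t) = F((z (x) 1) Delta(z) t) for all t in C2.

   To slide z * w or J(z), rewrite the expression to be simplified as
   F((z (x) 1) Delta(z) t') with a new t' in C2, slide z, and undo the rewriting.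
   For the star product, t' is obtained from t by coproducts and star products
   with central elements. For J, one links the two strands of t with two new
   strands by means of I = R_21 R: on four strands one uses
   (Delta (x) 1)(I)_123 . (I^-1)_23 . (1 (x) Delta)(I)_234, which commutes with
   the iterated coproduct because I commutes with Delta(A), and integrates out the
   first two strands together with t. *)
Require Import Defs.
From HB Require Import structures.
From mathcomp Require Import all_boot all_order all_algebra all_field.

Set Implicit Arguments.
Unset Strict Implicit.
Unset Printing Implicit Defensive.

Import GRing.Theory.
Local Open Scope ring_scope.

(** * Linearity and sums over tensors *)

Section Linearity.
Variable k : fieldType.
Implicit Types (U V W : lmodType k) (B : algType k).

(** A transparent form of [linear], convertible with it, on which the tactic [lin] can match. *)
Definition lin U W (f : U -> W) := forall c x y, f (c *: x + y) = c *: f x + f y.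

Lemma linB U V (f : U -> V) x y : lin f -> f (x - y) = f x - f y.
Proof.
move=> fL; have -> : x - y = -1 *: y + x by rewrite scaleN1r addrC.
by rewrite fL scaleN1r addrC.
Qed.

Lemma lin_id U : lin (fun x : U => x). Proof. by []. Qed.

Lemma lin_comp U V W (g : V -> W) (f : U -> V) :
  lin g -> lin f -> lin (fun x => g (f x)).
Proof. by move=> gL fL c x y; rewrite fL gL. Qed.

Lemma lin_sub U V (f g : U -> V) : lin f -> lin g -> lin (fun x => f x - g x).
Proof. by move=> fL gL c x y; rewrite fL gL scalerBr opprD addrACA. Qed.

Lemma lin_linear U V W (g : {linear V -> W}) (f : U -> V) :
  lin f -> lin (fun x => g (f x)).
Proof. by move=> fL c x y; rewrite fL linearP. Qed.

Lemma lin_lfun U (V W : vectType k) (g : 'Hom(V, W)) (f : U -> V) :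
  lin f -> lin (fun x => g (f x)).
Proof. by move=> fL c x y; rewrite fL linearP. Qed.

Lemma lin_scalel U V (f : U -> k^o) (v : V) : lin f -> lin (fun x => f x *: v).
Proof. by move=> fL c x y; rewrite fL scalerDl -scalerA. Qed.

Lemma lin_scaler U V (f : U -> V) (c : k) : lin f -> lin (fun x => c *: f x).
Proof. by move=> fL d x y; rewrite fL scalerDr !scalerA mulrC. Qed.

Lemma lin_mull U B (f : U -> B) (b : B) : lin f -> lin (fun x => f x * b).
Proof. by move=> fL c x y; rewrite fL mulrDl scalerAl. Qed.

Lemma lin_mulr U B (f : U -> B) (b : B) : lin f -> lin (fun x => b * f x).
Proof. by move=> fL c x y; rewrite fL mulrDr scalerAr. Qed.

Lemma lin_tprodl U (V W : vectType k) (f : U -> V) (w : W) :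
  lin f -> lin (fun x => f x \ox w).
Proof. by move=> fL c x y; rewrite fL (tprod_bilin V W).1. Qed.

Lemma lin_tprodr U (V W : vectType k) (f : U -> W) (v : V) :
  lin f -> lin (fun x => v \ox f x).
Proof. by move=> fL c x y; rewrite fL (tprod_bilin V W).2. Qed.

Lemma lin_tsumf U W (V1 V2 : vectType k) (f : U -> V1 -> V2 -> W) (y : V1 \ox V2) :
  (forall a b, lin (fun x => f x a b)) -> lin (fun x => \tsum_(a, b <- y) f x a b).
Proof. exact: tsum_linf. Qed.

Lemma lin_tsumx U W (V1 V2 : vectType k) (f : V1 -> V2 -> W) (g : U -> V1 \ox V2) :
  lin g -> lin (fun x => \tsum_(a, b <- g x) f a b).
Proof. by move=> gL c x y; rewrite gL tsum_is_linear. Qed.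

Lemma lin_tflip U (A : falgType k) (f : U -> A \ox A) :
  lin f -> lin (fun x => tflip (f x)).
Proof. exact: lin_tsumx. Qed.

End Linearity.

(** Proves linearity by peeling off the outermost construction; composition with a map whose
    linearity is a hypothesis is tried last. *)
Ltac lin := cbv beta; lazymatch goal with
  | |- bilin _ => split=> ?; lin
  | |- _ /\ _ => split; lin
  | |- forall _, _ => intro; lin
  | |- GRing.linear_for _ ?f => change (lin f); lin
  | |- lin _ => first
    [ exact: lin_id | assumption | apply: lin_tsumf; lin | apply: lin_tsumx; lin
    | apply: lin_tprodl; lin | apply: lin_tprodr; lin
    | apply: lin_tflip; lin
    | apply: lin_lfun; lin | apply: lin_linear; lin
    | apply: lin_sub; lin | apply: lin_mull; lin | apply: lin_mulr; lin
    | apply: lin_scalel; lin | apply: lin_scaler; lin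
    | match goal with fL : forall _, lin _ |- _ =>
        first [exact: fL | apply: (lin_comp (fL _)); lin] end
    | match goal with fL : lin _ |- _ => apply: (lin_comp fL); lin end
    | match goal with fL : forall _ _, lin _ |- _ =>
        first [exact: fL | apply: (lin_comp (fL _ _)); lin] end
    | match goal with fL : bilin _ |- _ =>
        first [exact: fL.1 | exact: fL.2 | apply: (lin_comp (fL.1 _)); lin
              | apply: (lin_comp (fL.2 _)); lin] end ]
  end.

Section TensorSums.
Variable k : fieldType.

Lemma eq_tsum (U V : vectType k) (W : lmodType k) (f g : U -> V -> W) x :
  (forall a b, f a b = g a b) -> tsum f x = tsum g x.
Proof. by move=> fg; apply: eq_bigr => i _; apply: eq_bigr => j _; rewrite fg. Qed.

Lemma lin_tsum (U V : vectType k) (W1 W2 : lmodType k) (g : W1 -> W2) (f : U -> V -> W1) x :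
  lin g -> g (tsum f x) = \tsum_(a, b <- x) g (f a b).
Proof.
move=> gL; have g0 : g 0 = 0.
  by have := gL 1 0 0; rewrite scaler0 addr0 scale1r => /esym/(canRL (addrK _)); rewrite subrr.
have gD u v : g (u + v) = g u + g v by rewrite -[u]scale1r gL !scale1r.
have gZ c u : g (c *: u) = c *: g u by rewrite -[c *: u]addr0 gL g0 addr0.
rewrite /tsum (big_morph g gD g0); apply: eq_bigr => i _.
by rewrite (big_morph g gD g0); apply: eq_bigr => j _; rewrite gZ.
Qed.

Lemma tsum_exchange (U V U' V' : vectType k) (W : lmodType k)
    (f : U -> V -> U' -> V' -> W) x y :
  \tsum_(a, b <- x) \tsum_(c, d <- y) f a b c d =
  \tsum_(c, d <- y) \tsum_(a, b <- x) f a b c d.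
Proof.
rewrite /tsum !pair_bigA /=.
under eq_bigr do rewrite pair_bigA scaler_sumr /=.
under [RHS]eq_bigr do rewrite pair_bigA scaler_sumr /=.
rewrite exchange_big; apply: eq_bigr => p _; apply: eq_bigr => q _.
by rewrite !scalerA mulrC.
Qed.

Variables A B : falgType k.

Lemma tsum_mul (W : lmodType k) (f : A -> B -> W) (x y : A \ox B) : bilin f ->
  \tsum_(a, b <- x * y) f a b =
  \tsum_(a, b <- x) \tsum_(c, d <- y) f (a * c) (b * d).
Proof.
move=> fB; rewrite -[x * y]/(tmul x y) /tmul.
rewrite (lin_tsum (g := fun t => tsum f t)); last by lin.
apply: eq_tsum => a b; rewrite (lin_tsum (g := fun t => tsum f t)); last by lin.
by apply: eq_tsum => c d; rewrite tsumE.
Qed.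

Lemma tsum_tens (U V : vectType k) (W : lmodType k) (f : A -> B -> W)
    (g : U -> V -> A) (h : U -> V -> B) (x : U \ox V) : bilin f ->
  \tsum_(a, b <- \tsum_(u, v <- x) (g u v \ox h u v)) f a b =
  \tsum_(u, v <- x) f (g u v) (h u v).
Proof.
move=> fB; rewrite (lin_tsum (g := fun t => tsum f t)); last by lin.
by apply: eq_tsum => a b; rewrite tsumE.
Qed.

Lemma tsum1 (W : lmodType k) (f : A -> B -> W) : bilin f ->
  \tsum_(a, b <- (1 : A \ox B)) f a b = f 1 1.
Proof. by move=> fB; rewrite -tprod1 tsumE. Qed.

(** The tensor product map is itself bilinear, and summing it over [x] returns [x]. *)
Lemma tens_tsum_eq (x y : A \ox B) :
  (forall (W : lmodType k) (f : A -> B -> W), bilin f -> tsum f x = tsum f y) -> x = y.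
Proof. by move=> xy; rewrite -[x]tens_sum -[y]tens_sum; apply: xy; lin. Qed.

End TensorSums.

Section Flip.
Variables (k : fieldType) (A : falgType k).

Lemma tsum_tflip (W : lmodType k) (f : A -> A -> W) (x : A \ox A) : bilin f ->
  \tsum_(a, b <- tflip x) f a b = \tsum_(a, b <- x) f b a.
Proof. by move=> fB; rewrite tsum_tens. Qed.

Lemma tflipK : involutive (@tflip k A).
Proof. by move=> x; rewrite {1}/tflip tsum_tflip ?tens_sum //; lin. Qed.

Lemma tflipE (a b : A) : tflip (a \ox b) = b \ox a.
Proof. by rewrite /tflip tsumE //; lin. Qed.

Lemma tflipM (x y : A \ox A) : tflip (x * y) = tflip x * tflip y.
Proof.
apply: tens_tsum_eq => W f fB; rewrite tsum_tflip // tsum_mul; last by lin.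
rewrite tsum_mul // tsum_tflip; last by lin.
by apply: eq_tsum => a b; rewrite tsum_tflip //; lin.
Qed.

Lemma tflip1 : tflip (1 : A \ox A) = 1.
Proof. by rewrite -tprod1 tflipE. Qed.

End Flip.

(** * Sweedler calculus *)

Section HopfTheory.
Variables (k : fieldType) (A : falgType k) (H : hopfAlgebra A).
Implicit Types (W : lmodType k) (a b c : A).
Local Notation S := (antipode H).
Local Notation Delta := (comul H).
Local Notation eps := (counit H).

(** Here and below, the Hopf axioms are put under an arbitrary linear [f], so that they can be
    rewritten in the middle of a Sweedler sum. *)
Lemma sum_counitl W (f : A -> W) a : lin f ->
  \tsum_(b, c <- Delta a) (eps b *: f c) = f a.
Proof.
move=> fL; rewrite -{2}(counitl H a) (lin_tsum _ _ fL); apply: eq_tsum => b c.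
by rewrite (linear_scale fL).
Qed.

Lemma sum_counitr W (f : A -> W) a : lin f ->
  \tsum_(b, c <- Delta a) (eps c *: f b) = f a.
Proof.
move=> fL; rewrite -{2}(counitr H a) (lin_tsum _ _ fL); apply: eq_tsum => b c.
by rewrite (linear_scale fL).
Qed.

Lemma sum_antipodel W (f : A -> W) a : lin f ->
  \tsum_(b, c <- Delta a) f (S b * c) = eps a *: f 1.
Proof. by move=> fL; rewrite -(linear_scale fL) -antipodel (lin_tsum _ _ fL). Qed.

Lemma sum_antipoder W (f : A -> W) a : lin f ->
  \tsum_(b, c <- Delta a) f (b * S c) = eps a *: f 1.
Proof. by move=> fL; rewrite -(linear_scale fL) -antipoder (lin_tsum _ _ fL). Qed.

Lemma sum_comulA W (f : A -> A -> A -> W) a :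
    (forall v w, lin (fun u => f u v w)) -> (forall u w, lin (fun v => f u v w)) ->
    (forall u v, lin (f u v)) ->
  \tsum_(b, c <- Delta a) \tsum_(d, e <- Delta b) f d e c =
  \tsum_(b, c <- Delta a) \tsum_(d, e <- Delta c) f b d e.
Proof.
move=> f1 f2 f3; pose G t := \tsum_(p, c <- t) \tsum_(a, b <- p) f a b c.
have GL : lin G by rewrite /G; lin.
have GE (p : A \ox A) c : G (p \ox c) = \tsum_(a, b <- p) f a b c.
  by rewrite /G tsumE //; lin.
have := congr1 G (comulA H a); rewrite !(lin_tsum _ _ GL).
under eq_tsum do rewrite GE; move=> ->; apply: eq_tsum => b c.
by rewrite (lin_tsum _ _ GL); apply: eq_tsum => d e; rewrite GE tsumE //; lin.
Qed.

Lemma sum_comulM W (f : A -> A -> W) a b : bilin f ->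
  \tsum_(c, d <- Delta (a * b)) f c d =
  \tsum_(a1, a2 <- Delta a) \tsum_(b1, b2 <- Delta b) f (a1 * b1) (a2 * b2).
Proof. by move=> fB; rewrite rmorphM tsum_mul. Qed.

Lemma comul1 : Delta 1 = 1. Proof. exact: rmorph1. Qed.

Lemma sum_comul1 W (f : A -> A -> W) : bilin f -> \tsum_(c, d <- Delta 1) f c d = f 1 1.
Proof. by move=> fB; rewrite comul1 tsum1. Qed.

Lemma sum_antipodell W (f : A -> A -> W) a : bilin f ->
  \tsum_(b, c <- Delta a) \tsum_(d, e <- Delta b) f (S d * e) c = f 1 a.
Proof.
move=> fB; under eq_tsum => b c do (rewrite (sum_antipodel (f := f^~ c)); last by lin).
by rewrite sum_counitl //; lin.
Qed.

Lemma sum_antipoderl W (f : A -> A -> W) a : bilin f ->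
  \tsum_(b, c <- Delta a) \tsum_(d, e <- Delta b) f (d * S e) c = f 1 a.
Proof.
move=> fB; under eq_tsum => b c do (rewrite (sum_antipoder (f := f^~ c)); last by lin).
by rewrite sum_counitl //; lin.
Qed.

Lemma sum_antipoderr W (f : A -> A -> W) a : bilin f ->
  \tsum_(b, c <- Delta a) \tsum_(d, e <- Delta c) f b (d * S e) = f a 1.
Proof.
move=> fB; under eq_tsum => b c do (rewrite (sum_antipoder (f := f b)); last by lin).
by rewrite (sum_counitr (f := f^~ 1)) //; lin.
Qed.

Lemma antipode1 : S 1 = 1.
Proof.
have := antipodel H 1; rewrite sum_comul1 ?mulr1; last by lin.
by rewrite rmorph1 scale1r.
Qed.

(** Inserting [b2 * S b3] gives [X]. Inserting [a2 * S a3] after S(a b) and applying [X] then leaves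
    S(b) S(a). *)
Lemma antipodeM a b : S (a * b) = S b * S a.
Proof.
have X c : \tsum_(a1, a2 <- Delta c) (S (a1 * b) * a2) = eps c *: S b.
  transitivity (\tsum_(b1, b2 <- Delta b) \tsum_(a1, a2 <- Delta c)
      \tsum_(b3, b4 <- Delta b1) (S (a1 * b3) * (a2 * b4) * S b2)); last first.
    rewrite -(sum_counitl b (f := fun b => eps c *: S b)); last by lin.
    apply: eq_tsum => b1 b2.
    rewrite -(sum_comulM c b1 (f := fun x y => S x * y * S b2)); last by lin.
    rewrite (sum_antipodel (c * b1) (f := fun x => x * S b2)); last by lin.
    by rewrite mul1r rmorphM scalerA mulrC.
  rewrite tsum_exchange; apply: eq_tsum => a1 a2.
  rewrite (sum_comulA (f := fun b1 b2 b3 => S (a1 * b1) * (a2 * b2) * S b3)); [|lin..].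
  under eq_tsum => b1 b2 do under eq_tsum => b3 b4 do rewrite -mulrA -[a2 * _ * _]mulrA.
  rewrite (sum_antipoderr (f := fun x y => S (a1 * x) * (a2 * y))); last by lin.
  by rewrite mulr1.
transitivity (\tsum_(a1, a2 <- Delta a) \tsum_(a3, a4 <- Delta a1) (S (a3 * b) * a4 * S a2)).
  rewrite (sum_comulA (f := fun a1 a2 a3 => S (a1 * b) * a2 * S a3)); [|lin..].
  under eq_tsum => a1 a2 do under eq_tsum => a3 a4 do rewrite -mulrA.
  by rewrite (sum_antipoderr (f := fun x y => S (x * b) * y)) ?mulr1 //; lin.
rewrite -[RHS](sum_counitl a (f := fun a => S b * S a)); last by lin.
apply: eq_tsum => a1 a2.
rewrite -(lin_tsum (g := fun x => x * S a2)); last by lin.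
by rewrite X scalerAl.
Qed.

Lemma counit_antipode a : eps (S a) = eps a.
Proof.
have := congr1 eps (antipodel H a); rewrite (lin_tsum (g := eps)); last by lin.
rewrite linearZ /= rmorph1 [RHS]mulr1 => <-.
rewrite -{1}(counitr H a) (lin_tsum (g := S)) ?(lin_tsum (g := eps)); [|lin..].
by apply: eq_tsum => b c; rewrite rmorphM !linearZ mulrC.
Qed.

(** In the convolution algebra of maps from [A] to [B], a left inverse of [h] equals a right
    inverse: evaluate the triple product of [f], [h], [f'] in two ways. *)
Lemma conv_inverse_unique (B : algType k) (f h f' : A -> B) :
    lin f -> lin h -> lin f' ->
    (forall a, \tsum_(b, c <- Delta a) (f b * h c) = eps a *: 1) ->
    (forall a, \tsum_(b, c <- Delta a) (h b * f' c) = eps a *: 1) ->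
  f =1 f'.
Proof.
move=> fL hL fL' fh hf a.
rewrite -[LHS](sum_counitr a fL) -[RHS](sum_counitl a fL').
transitivity (\tsum_(b, c <- Delta a) \tsum_(d, e <- Delta c) (f b * h d * f' e)).
  apply: eq_tsum => b c; under eq_tsum => d e do rewrite -mulrA.
  rewrite -(lin_tsum (g := fun x => f b * x)); last by lin.
  by rewrite hf -scalerAr mulr1.
rewrite -(sum_comulA (f := fun x y z => f x * h y * f' z)); [|lin..].
apply: eq_tsum => b c; rewrite -(lin_tsum (g := fun x => x * f' c)); last by lin.
by rewrite fh -scalerAl mul1r.
Qed.

(** The left side is a left convolution inverse of [Delta], the right side a right one. *)
Lemma comul_antipode a : Delta (S a) = \tsum_(b, c <- Delta a) (S c \ox S b).
Proof.
move: a; apply: (conv_inverse_unique (h := Delta)); [lin..| |] => a.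
  under eq_tsum => b c do rewrite -rmorphM.
  by rewrite (sum_antipodel a (f := Delta)) ?rmorph1 //; lin.
transitivity (\tsum_(b, c <- Delta a) \tsum_(d, e <- Delta b) \tsum_(x, y <- Delta c)
   ((d * S y) \ox (e * S x))).
  apply: eq_tsum => b c; rewrite -{1}[Delta b]tens_sum.
  rewrite (lin_tsum (g := fun x => x * _)); last by lin.
  apply: eq_tsum => d e; rewrite (lin_tsum (g := fun x => _ * x)); last by lin.
  by apply: eq_tsum => x y; rewrite tprodM.
rewrite (sum_comulA (f := fun d e c => \tsum_(x, y <- Delta c) ((d * S y) \ox (e * S x)))); [|lin..].
transitivity (\tsum_(b, c <- Delta a) ((b * S c) \ox (1 : A))); last first.
  by rewrite (sum_antipoder a (f := fun x => x \ox (1 : A))) //; lin.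
apply: eq_tsum => d c.
rewrite -(sum_comulA (f := fun e x y => (d * S y) \ox (e * S x))); [|lin..].
by rewrite (sum_antipoderl c (f := fun x y => (d * S y) \ox x)) //; lin.
Qed.

Lemma sum_comul_antipode W (f : A -> A -> W) a : bilin f ->
  \tsum_(b, c <- Delta (S a)) f b c = \tsum_(b, c <- Delta a) f (S c) (S b).
Proof. by move=> fB; rewrite comul_antipode tsum_tens. Qed.

End HopfTheory.

(** * Integrals and the star product *)

Section RibbonHopf.
Variables (k : fieldType) (A : falgType k) (H : ribbonHopfAlgebra A).
Variables (Lam : A) (lam : 'Hom(A, k^o)).
Hypothesis intLam : two_sided_integral H Lam.
Hypothesis intlam : dual_right_integral H lam.
Hypothesis lamLam : lam Lam = 1.
Implicit Types (W : lmodType k) (a b c e p q w z : A).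
Local Notation S := (antipode H).
Local Notation Delta := (comul H).
Local Notation eps := (counit H).
Local Notation Z := ('Z({:A}))%VS.
Local Notation R := (Rmx H).
Local Notation "a ⋆ b" := (star H lam a b) (at level 40, left associativity).

Let starB : bilin (star H lam). Proof. by rewrite /star; lin. Qed.

Definition antipode_inv : 'End(A) := (antipode H)^-1%VF.
Local Notation Si := antipode_inv.

(** The square of S is conjugation by the pivot, hence injective. In finite dimension [antipode_inv]
    is then a two-sided inverse. *)
Lemma lker_antipode : lker S == 0%VS.
Proof.
apply/lker0P => x y Sxy; apply: (mulIr (x := (pivot H)^-1)); first by rewrite unitrV pivot_unit.
apply: (mulrI (pivot_unit H)); rewrite !mulrA -!antipode_sqr; exact: congr1.
Qed.

Lemma antipodeK : cancel S Si. Proof. by move=> x; rewrite lker0_lfunK ?lker_antipode. Qed.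

Lemma antipode_invK : cancel Si S. Proof. by move=> x; rewrite lker0_lfunVK ?lker_antipode. Qed.

Lemma comul_antipode_inv a : Delta (Si a) = \tsum_(b, c <- Delta a) (Si c \ox Si b).
Proof.
have E : Delta a = \tsum_(b, c <- Delta (Si a)) (S c \ox S b).
  by rewrite -comul_antipode antipode_invK.
rewrite E tsum_tens; last by lin.
by rewrite -[LHS]tens_sum; apply: eq_tsum => b c; rewrite !antipodeK.
Qed.

(** The inverse of S is the antipode for the opposite coproduct, whence the reversed order of the
    factors. *)
Lemma sum_antipode_invl W (f : A -> W) a : lin f ->
  \tsum_(b, c <- Delta a) f (Si c * b) = eps a *: f 1.
Proof.
move=> fL; rewrite -[a]antipode_invK counit_antipode sum_comul_antipode; last by lin.
rewrite -(sum_antipoder _ _ fL); apply: eq_tsum => b c; by rewrite antipodeK.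
Qed.

Lemma sum_antipode_invr W (f : A -> W) a : lin f ->
  \tsum_(b, c <- Delta a) f (c * Si b) = eps a *: f 1.
Proof.
move=> fL; rewrite -[a]antipode_invK counit_antipode sum_comul_antipode; last by lin.
rewrite -(sum_antipodel _ _ fL); apply: eq_tsum => b c; by rewrite antipodeK.
Qed.

Lemma sum_antipode_invrl W (f : A -> A -> W) a : bilin f ->
  \tsum_(b, c <- Delta a) \tsum_(d, e <- Delta b) f (e * Si d) c = f 1 a.
Proof.
move=> fB; under eq_tsum => b c do (rewrite (sum_antipode_invr _ (f := f^~ c)); last by lin).
by rewrite sum_counitl //; lin.
Qed.

(** Replace 1 ⊗ a by the sum of S(a1) a2 ⊗ a3; the last two factors multiply Delta(Lam) to the
    coproduct of a2 Lam, a multiple of Lam. *)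
Lemma LamL W (f : A -> A -> W) a : bilin f ->
  \tsum_(c, d <- Delta Lam) f (S a * c) d = \tsum_(c, d <- Delta Lam) f c (a * d).
Proof.
move=> fB; pose F x y := \tsum_(c, d <- Delta Lam) f (x * c) (y * d).
have FB : bilin F by rewrite /F; lin.
transitivity (F 1 a); last by apply: eq_tsum => c d; rewrite mul1r.
rewrite -(sum_antipodell H a FB).
rewrite (sum_comulA H (f := fun x y z => F (S x * y) z)); [|lin..].
rewrite -(sum_counitr H a (f := fun x => \tsum_(c, d <- Delta Lam) f (S x * c) d)); last by lin.
apply: eq_tsum => a1 a2.
transitivity (\tsum_(c, d <- Delta (a2 * Lam)) f (S a1 * c) d).
  by rewrite intLam.1 (linear_scale (f := fun x => \tsum_(c, d <- Delta x) f (S a1 * c) d)) //; lin.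
rewrite sum_comulM /F; last by lin.
by do 2![apply: eq_tsum => ? ?]; rewrite mulrA.
Qed.

Lemma LamR W (f : A -> A -> W) a : bilin f ->
  \tsum_(c, d <- Delta Lam) f (c * a) d = \tsum_(c, d <- Delta Lam) f c (d * S a).
Proof.
move=> fB; pose F x y := \tsum_(c, d <- Delta Lam) f (c * x) (d * y).
have FB : bilin F by rewrite /F; lin.
transitivity (F a 1); first by apply: eq_tsum => c d; rewrite mulr1.
rewrite -(sum_antipoderr H a FB).
rewrite -(sum_comulA H (f := fun x y z => F x (y * S z))); [|lin..].
rewrite -(sum_counitl H a (f := fun x => \tsum_(c, d <- Delta Lam) f c (d * S x))); last by lin.
apply: eq_tsum => a1 a2.
transitivity (\tsum_(c, d <- Delta (Lam * a1)) f c (d * S a2)); last first.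
  by rewrite intLam.2 (linear_scale (f := fun x => \tsum_(c, d <- Delta x) f c (d * S a2))) //; lin.
rewrite sum_comulM; last by lin.
rewrite /F tsum_exchange.
by do 2![apply: eq_tsum => ? ?]; rewrite mulrA.
Qed.

(** In star notation this is [a ⋆ Lam = a]: Lam is a right unit. *)
Lemma lam_LamL a : \tsum_(c, d <- Delta Lam) (lam (S a * c) *: d) = a.
Proof.
rewrite (LamL (f := fun c d => lam c *: d)); last by lin.
under eq_tsum do rewrite scalerAr.
rewrite -(lin_tsum (g := fun x => a * x)); last by lin.
by rewrite intlam lamLam scale1r mulr1.
Qed.

Lemma lam_LamR a : \tsum_(c, d <- Delta Lam) (lam (c * a) *: d) = S a.
Proof.
rewrite (LamR (f := fun c d => lam c *: d)); last by lin.
under eq_tsum do rewrite scalerAl.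
rewrite -(lin_tsum (g := fun x => x * S a)); last by lin.
by rewrite intlam lamLam scale1r mul1r.
Qed.

(* [lam_LamL] says that the matrix of [Delta Lam] has a left inverse; in finite
   dimension it is then invertible. *)
Lemma Lam_nondegenerate (f : A -> k^o) : lin f ->
  \tsum_(c, d <- Delta Lam) (f c *: d) = 0 -> forall x, f x = 0.
Proof.
move=> fL f0 x; set e := vbasis {:A}.
have eF : free e := basis_free (vbasisP _).
have coE (i j : 'I_(\dim {:A})) : coord e i e`_j = (j == i)%:R by apply: coord_free.
pose M : 'M[k]_(\dim {:A}) := Delta Lam.
pose L : 'M[k]_(\dim {:A}) := \matrix_(i, j) lam (S e`_i * e`_j).
have LM : L *m M = 1%:M.
  apply/matrixP => i j; rewrite !mxE -coE -(lam_LamL e`_i) /tsum linear_sum.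
  apply: eq_bigr => l _ /=; rewrite linear_sum (bigD1 j) //= !linearZ /= coE eqxx mulr1.
  rewrite !mxE mulrC big1 ?addr0 // => m nm; rewrite !linearZ /= coE (negPf nm) !mulr0 //.
pose v : 'rV[k]_(\dim {:A}) := \row_i f e`_i.
have fM : v *m M = 0.
  apply/matrixP => i j; rewrite !mxE.
  have /esym := congr1 (coord e j) f0; rewrite linear0 /tsum linear_sum => fE; rewrite [RHS]fE.
  apply: eq_bigr => l _ /=; rewrite linear_sum (bigD1 j) //= !linearZ /= coE eqxx mulr1.
  rewrite !mxE mulrC big1 ?addr0 // => m nm; rewrite !linearZ /= coE (negPf nm) !mulr0 //.
have f0e : v = 0.
  by rewrite -[v]mulmx1 -(mulmx1C LM) mulmxA fM mul0mx.
rewrite (coord_vbasis (memvf x)) (linear_sumZ _ _ fL) big1 // => i _.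
by have /matrixP/(_ 0 i) := f0e; rewrite !mxE => ->; rewrite scaler0.
Qed.

(** As functions of [x], both sides give S(a) when contracted with the first leg of Delta(Lam), by
    [lam_LamR] and [lam_LamL]; nondegeneracy concludes. *)
Lemma lam_trace x a : lam (x * a) = lam (S (S a) * x).
Proof.
apply/eqP; rewrite -subr_eq0; apply/eqP.
apply: (Lam_nondegenerate (f := fun x => lam (x * a) - lam (S (S a) * x))); first by lin.
transitivity (\tsum_(c, d <- Delta Lam) (lam (c * a) *: d) -
              \tsum_(c, d <- Delta Lam) (lam (S (S a) * c) *: d)).
  rewrite /tsum -sumrB; apply: eq_bigr => i _; rewrite -sumrB; apply: eq_bigr => j _.
  by rewrite scalerBl scalerBr.
by rewrite lam_LamR lam_LamL subrr.
Qed.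

(** Insert [p2 * S p3]; then w1 p1 ⊗ w2 p2 is a coproduct, which the right integral contracts. *)
Lemma lam_comul_mul w p :
  \tsum_(w1, w2 <- Delta w) (lam (w1 * p) *: w2) =
  \tsum_(p1, p2 <- Delta p) (lam (w * p1) *: S p2).
Proof.
pose F x y := \tsum_(w1, w2 <- Delta w) (lam (w1 * x) *: (w2 * y)).
have FB : bilin F by rewrite /F; lin.
transitivity (F p 1); first by apply: eq_tsum => c d; rewrite mulr1.
rewrite -(sum_antipoderr H p FB).
rewrite -(sum_comulA H (f := fun x y z => F x (y * S z))); [|lin..].
apply: eq_tsum => p1 p2; rewrite /F tsum_exchange.
under eq_tsum do under eq_tsum do rewrite mulrA scalerAl.
rewrite -(sum_comulM H w p1 (f := fun x y => lam x *: y * S p2)); last by lin.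
rewrite -(lin_tsum (g := fun x => x * S p2)); last by lin.
by rewrite intlam -scalerAl mul1r.
Qed.

(** Insert [a1 * S a2] before the second leg of [b]; the antipodes combine into one coproduct,
    contracted by [lam]. *)
Lemma star_altE a b : a ⋆ b = \tsum_(a1, a2 <- Delta a) (lam (S a2 * b) *: a1).
Proof.
pose F x y := \tsum_(b1, b2 <- Delta b) (lam (x * b1) *: (y * b2)).
have FB : bilin F by rewrite /F; lin.
transitivity (F (S a) 1); first by apply: eq_tsum => c d; rewrite mul1r.
pose G x y := F (S y) x; have GB : bilin G by rewrite /G; lin.
rewrite -[F _ _]/(G 1 a) -(sum_antipoderl H a GB).
rewrite (sum_comulA H (f := fun x y z => G (x * S y) z)); [|lin..].
apply: eq_tsum => a1 a2; rewrite /G /F.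
under eq_tsum do under eq_tsum do rewrite -mulrA scalerAr.
rewrite -(sum_comul_antipode H a2 (f := fun x y => \tsum_(c, d <- Delta b) (a1 * (lam (x * c) *: (y * d))))); last by lin.
rewrite -(sum_comulM H (S a2) b (f := fun x y => a1 * (lam x *: y))); last by lin.
rewrite -(lin_tsum (g := fun x => a1 * x)); last by lin.
by rewrite intlam -scalerAr mulr1.
Qed.

(** The duality between ⋆ and the coproduct under the form lam(a b). *)
Lemma lam_mul_star w p q :
  lam (w * (p ⋆ q)) = \tsum_(w1, w2 <- Delta w) (lam (w1 * p) * lam (w2 * q)).
Proof.
rewrite star_altE (lin_tsum (g := fun x => lam (w * x))); last by lin.
have -> : \tsum_(w1, w2 <- Delta w) (lam (w1 * p) * lam (w2 * q)) =
    lam ((\tsum_(w1, w2 <- Delta w) (lam (w1 * p) *: w2)) * q).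
  rewrite (lin_tsum (g := fun x => lam (x * q))); last by lin.
  by apply: eq_tsum => a b; rewrite -scalerAl linearZ.
rewrite lam_comul_mul (lin_tsum (g := fun x => lam (x * q))); last by lin.
by apply: eq_tsum => a b; rewrite -scalerAl -scalerAr !linearZ; apply: mulrC.
Qed.

(** Both sides equal lam(b (S^-1(a) ⋆ q)), since [lam_trace] turns S^-1(a) on the right into S(a) on
    the left. *)
Lemma lam_star_mul a b q :
  lam ((a ⋆ b) * q) = \tsum_(q1, q2 <- Delta q) (lam (a * q1) * lam (b * q2)).
Proof.
rewrite /star (lin_tsum (g := fun x => lam (x * q))); last by lin.
transitivity (lam (b * (Si a ⋆ q))).
  rewrite lam_mul_star; apply: eq_tsum => b1 b2.
  by rewrite -scalerAl linearZ lam_trace antipode_invK.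
rewrite /star antipode_invK (lin_tsum (g := fun x => lam (b * x))); last by lin.
by apply: eq_tsum => c d; rewrite -scalerAr linearZ.
Qed.

(** With [star_mull], this makes ⋆ a bimodule morphism, A acting on A ⊗ A through Delta. On the
    right side the inserted factor must pass around [lam] by [lam_trace], hence the inverse
    antipode. *)
Lemma star_mulr b c d :
  (b ⋆ c) * d = \tsum_(d1, d2 <- Delta d) ((b * d1) ⋆ (c * d2)).
Proof.
pose F x y := \tsum_(c1, c2 <- Delta c) (lam (S b * c1 * x) *: (c2 * y)).
have FB : bilin F by rewrite /F; lin.
transitivity (F 1 d).
  rewrite /star (lin_tsum (g := fun x => x * d)); last by lin.
  by apply: eq_tsum => *; rewrite mulr1 scalerAl.
rewrite -(sum_antipode_invrl d FB).
rewrite (sum_comulA H (f := fun x y z => F (y * Si x) z)); [|lin..].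
apply: eq_tsum => d1 d2; rewrite /star sum_comulM; last by lin.
rewrite /F tsum_exchange; apply: eq_tsum => c1 c2; apply: eq_tsum => d3 d4.
by rewrite antipodeM [X in lam X]mulrA lam_trace antipode_invK !mulrA.
Qed.

Lemma star_mull b c d :
  d * (b ⋆ c) = \tsum_(d1, d2 <- Delta d) ((d1 * b) ⋆ (d2 * c)).
Proof.
pose F x y := \tsum_(c1, c2 <- Delta c) (lam (S b * x * c1) *: (y * c2)).
have FB : bilin F by rewrite /F; lin.
transitivity (F 1 d).
  rewrite /star (lin_tsum (g := fun x => d * x)); last by lin.
  by apply: eq_tsum => *; rewrite mulr1 scalerAr.
rewrite -(sum_antipodell H d FB).
rewrite (sum_comulA H (f := fun x y z => F (S x * y) z)); [|lin..].
apply: eq_tsum => d1 d2; rewrite /star sum_comulM; last by lin.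
by rewrite /F; do 2![apply: eq_tsum => ? ?]; rewrite antipodeM !mulrA.
Qed.

(** Expanding b ⋆ c by [star_altE] and a ⋆ b by definition, both sides become the sum of lam(S(a)
    b1) lam(S(b3) c) b2. *)
Lemma starA a b c : a ⋆ (b ⋆ c) = (a ⋆ b) ⋆ c.
Proof.
rewrite [b ⋆ c]star_altE (lin_tsum (g := star H lam a)); last by lin.
rewrite [in RHS](_ : a ⋆ b = \tsum_(b1, b2 <- Delta b) (lam (S a * b1) *: b2)) //.
rewrite (lin_tsum (g := fun x => x ⋆ c)); last by lin.
transitivity (\tsum_(b1, b2 <- Delta b) \tsum_(b3, b4 <- Delta b1)
   (lam (S a * b3) *: (lam (S b2 * c) *: b4))).
  apply: eq_tsum => b1 b2; rewrite (linear_scale (starB.2 a)) /star.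
  rewrite (lin_tsum (g := fun x => _ *: x)); last by lin.
  by apply: eq_tsum => x y; rewrite !scalerA mulrC.
rewrite (sum_comulA H (f := fun x y z => lam (S a * x) *: (lam (S z * c) *: y))); [|lin..].
apply: eq_tsum => b1 b2; rewrite (linear_scale (starB.1 c)) star_altE.
by rewrite (lin_tsum (g := fun x => _ *: x)) //; lin.
Qed.

(** The case a = Lam of [lam_LamR], whose left side collapses to Lam. *)
Lemma antipode_Lam : S Lam = Lam.
Proof.
rewrite -(lam_LamR Lam).
under eq_tsum => c d do (rewrite intLam.1 linearZ -scalerA).
by rewrite (sum_counitl H Lam (f := fun x => lam Lam *: x)) ?lamLam ?scale1r //; lin.
Qed.

Lemma star1l b : Lam ⋆ b = b.
Proof.
rewrite /star antipode_Lam.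
under eq_tsum => c d do (rewrite intLam.2 linearZ -scalerA).
rewrite (sum_counitl H b (f := fun x => lam Lam *: x)) ?lamLam ?scale1r //; lin.
Qed.

Lemma lam_antipode_left a : \tsum_(b, c <- Delta a) (lam (S c) *: b) = lam (S a) *: 1.
Proof.
apply: (can_inj antipodeK).
rewrite (lin_tsum (g := S)); last by lin.
rewrite linearZ /= antipode1 -intlam sum_comul_antipode; last by lin.
by apply: eq_tsum => b c; rewrite linearZ.
Qed.

(** Starring with 1 integrates out a leg; this is how stability of C2 under ⋆ yields the centrality
    of [kill] and [cokill]. *)
Lemma star_1r a : a ⋆ 1 = lam (S a) *: 1.
Proof. by rewrite /star sum_comul1 ?mulr1 //; lin. Qed.

Lemma star_1l a : 1 ⋆ a = lam a *: 1.
Proof.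
by rewrite /star antipode1 -intlam; apply: eq_tsum => b c; rewrite mul1r.
Qed.

(** * The R-matrix *)

Lemma centerP a : reflect (forall b, a * b = b * a) (a \in Z).
Proof.
rewrite memv_cap memvf /=; apply: (iffP centvP) => [aC b|aC b _]; last by rewrite aC.
by rewrite aC ?memvf.
Qed.

Lemma Rmx_unit : R \is a GRing.unit. Proof. by case: (RmxP H). Qed.

Lemma tflip_comul a : tflip (Delta a) * R = R * Delta a.
Proof. by case: (RmxP H) => Ru -> _ _; rewrite mulrVK. Qed.

Let legs W (f : A -> A -> A -> W) (t : A \ox A \ox A) :=
  \tsum_(p, c <- t) \tsum_(a, b <- p) f a b c.

Let legsE W (f : A -> A -> A -> W) (p : A \ox A) c :
    (forall v w, lin (fun u => f u v w)) -> (forall u w, lin (fun v => f u v w)) ->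
    (forall u v, lin (f u v)) ->
  legs f (p \ox c) = \tsum_(a, b <- p) f a b c.
Proof. by move=> f1 f2 f3; rewrite /legs tsumE //; lin. Qed.

Let legs_lin W (f : A -> A -> A -> W) : lin (legs f).
Proof. by rewrite /legs; lin. Qed.

Lemma sum_Rmx_comull W (f : A -> A -> A -> W) :
    (forall v w, lin (fun u => f u v w)) -> (forall u w, lin (fun v => f u v w)) ->
    (forall u v, lin (f u v)) ->
  \tsum_(a, b <- R) \tsum_(c, d <- Delta a) f c d b =
  \tsum_(a, b <- R) \tsum_(c, d <- R) f a c (b * d).
Proof.
move=> f1 f2 f3; have := legs_lin f => fL.
transitivity (legs f (\tsum_(a, b <- R) (Delta a \ox b))).
  by rewrite (lin_tsum _ _ fL); apply: eq_tsum => a b; rewrite legsE.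
case: (RmxP H) => _ _ -> _.
rewrite /leg13 (lin_tsum (g := fun t => t * _)) ?(lin_tsum _ _ fL); [|lin..].
apply: eq_tsum => a b; rewrite /leg23 (lin_tsum (g := fun t => _ * t)) ?(lin_tsum _ _ fL); [|lin..].
by apply: eq_tsum => c d; rewrite !tprodM mulr1 mul1r legsE // tsumE //; lin.
Qed.

Lemma sum_Rmx_comulr W (f : A -> A -> A -> W) :
    (forall v w, lin (fun u => f u v w)) -> (forall u w, lin (fun v => f u v w)) ->
    (forall u v, lin (f u v)) ->
  \tsum_(a, b <- R) \tsum_(c, d <- Delta b) f a c d =
  \tsum_(a, b <- R) \tsum_(c, d <- R) f (a * c) d b.
Proof.
move=> f1 f2 f3; have := legs_lin f => fL.
transitivity (legs f (\tsum_(a, b <- R) \tsum_(c, d <- Delta b) (a \ox c \ox d))).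
  rewrite (lin_tsum _ _ fL); apply: eq_tsum => a b; rewrite (lin_tsum _ _ fL).
  by apply: eq_tsum => c d; rewrite legsE // tsumE //; lin.
case: (RmxP H) => _ _ _ ->.
rewrite /leg13 (lin_tsum (g := fun t => t * _)) ?(lin_tsum _ _ fL); [|lin..].
apply: eq_tsum => a b; rewrite /leg12 -{1}[R]tens_sum.
rewrite (lin_tsum (g := fun t : A \ox A => _ * (t \ox (1 : A)))) ?(lin_tsum _ _ fL); [|lin..].
by apply: eq_tsum => c d; rewrite !tprodM mulr1 mul1r legsE // tsumE //; lin.
Qed.

(** Applying [eps] to the first of the three legs of (Delta ⊗ 1)R gives R = (1 ⊗ r) R, with r the
    left side; cancel R. *)
Lemma counit_Rmxl : \tsum_(a, b <- R) (eps a *: b) = 1.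
Proof.
have RE : R = (1 \ox (\tsum_(a, b <- R) (eps a *: b))) * R.
  rewrite -{1}[R]tens_sum.
  transitivity (\tsum_(a, b <- R) \tsum_(c, d <- Delta a) (eps c *: (d \ox b))).
    by apply: eq_tsum => a b; rewrite (sum_counitl H a (f := fun x => x \ox b)) //; lin.
  rewrite (sum_Rmx_comull (f := fun c d b => eps c *: (d \ox b))); [|lin..].
  rewrite (lin_tsum (g := fun u : A => ((1 : A) \ox u) * R)); last by lin.
  apply: eq_tsum => a b; rewrite -{2}[R]tens_sum (lin_tsum (g := fun t => _ * t)); last by lin.
  apply: eq_tsum => c d; rewrite tprodM mul1r -scalerAl.
  by rewrite (linear_scale ((tprod_bilin A A).2 c)).
move: RE; rewrite -{1}[R]mul1r => /(mulIr Rmx_unit) /esym RE.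
have fB : bilin (fun a b => eps a *: b) by lin.
by have := congr1 (tsum (fun a b => eps a *: b)) RE; rewrite tsum1 // tsumE // !rmorph1 !scale1r.
Qed.

Lemma counit_Rmxr : \tsum_(a, b <- R) (eps b *: a) = 1.
Proof.
have RE : R = ((\tsum_(a, b <- R) (eps b *: a)) \ox 1) * R.
  rewrite -{1}[R]tens_sum.
  transitivity (\tsum_(a, b <- R) \tsum_(c, d <- Delta b) (eps d *: (a \ox c))).
    by apply: eq_tsum => a b; rewrite (sum_counitr H b (f := fun x => a \ox x)) //; lin.
  rewrite (sum_Rmx_comulr (f := fun a c d => eps d *: (a \ox c))); [|lin..].
  rewrite (lin_tsum (g := fun u : A => (u \ox (1 : A)) * R)); last by lin.
  apply: eq_tsum => a b; rewrite -{2}[R]tens_sum (lin_tsum (g := fun t => _ * t)); last by lin.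
  apply: eq_tsum => c d; rewrite tprodM mul1r -scalerAl.
  by rewrite (linear_scale ((tprod_bilin A A).1 d)).
move: RE; rewrite -{1}[R]mul1r => /(mulIr Rmx_unit) /esym RE.
have fB : bilin (fun a b => eps b *: a) by lin.
by have := congr1 (tsum (fun a b => eps b *: a)) RE; rewrite tsum1 // tsumE // !rmorph1 !scale1r.
Qed.

Lemma sum_mul_tens (f g : A -> A) (y : A \ox A) :
  (\tsum_(a, b <- R) (f a \ox g b)) * y =
  \tsum_(a, b <- R) \tsum_(c, d <- y) ((f a * c) \ox (g b * d)).
Proof.
rewrite (lin_tsum (g := fun t => t * _)); last by lin.
apply: eq_tsum => a b; rewrite -{1}[y]tens_sum (lin_tsum (g := fun t => _ * t)); last by lin.
by apply: eq_tsum => c d; rewrite tprodM.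
Qed.

Lemma Rmx_inv : R^-1 = \tsum_(a, b <- R) (S a \ox b).
Proof.
apply: (mulIr Rmx_unit); rewrite mulVr ?Rmx_unit // (sum_mul_tens S id).
rewrite -(sum_Rmx_comull (f := fun x y z => (S x * y) \ox z)); [|lin..].
under eq_tsum => a b do (rewrite (sum_antipodel H a (f := fun x => x \ox b)); last by lin).
rewrite -tprod1 -{2}counit_Rmxl (lin_tsum (g := fun u : A => (1 : A) \ox u)); last by lin.
by apply: eq_tsum => a b; rewrite (linear_scale ((tprod_bilin A A).2 1)).
Qed.

Lemma Rmx_inv_antipode_inv : R^-1 = \tsum_(a, b <- R) (a \ox Si b).
Proof.
apply: (mulIr Rmx_unit); rewrite mulVr ?Rmx_unit // (sum_mul_tens id Si).
rewrite -(sum_Rmx_comulr (f := fun x y z => x \ox (Si z * y))); [|lin..].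
under eq_tsum => a b do (rewrite (sum_antipode_invl b (f := fun x => a \ox x)); last by lin).
rewrite -tprod1 -{1}counit_Rmxr (lin_tsum (g := fun u : A => u \ox (1 : A))); last by lin.
by apply: eq_tsum => a b; rewrite (linear_scale ((tprod_bilin A A).1 1)).
Qed.

(** The inverse of R is both (S ⊗ 1)R and (1 ⊗ S^-1)R; apply 1 ⊗ S. *)
Lemma Rmx_antipode : \tsum_(a, b <- R) (S a \ox S b) = R.
Proof.
have fB : bilin (fun a b => a \ox S b) by lin.
have := tsum_tens (fun a _ => S a) (fun _ b => b) R fB; rewrite -Rmx_inv Rmx_inv_antipode_inv.
rewrite tsum_tens // => <-; rewrite -[RHS]tens_sum.
by apply: eq_tsum => a b; rewrite antipode_invK.
Qed.

Lemma sum_Rmx_antipode W (f : A -> A -> W) : bilin f ->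
  \tsum_(a, b <- R) f (S a) (S b) = \tsum_(a, b <- R) f a b.
Proof. by move=> fB; rewrite -{2}Rmx_antipode tsum_tens. Qed.

(** The element R_21 R, written I in the sketch of the proof; its inverse is abbreviated [N]
    below. *)
Definition monodromy : A \ox A := tflip R * R.
Local Notation M := monodromy.

Lemma monodromy_inv : M * (R^-1 * tflip R^-1) = 1 /\ (R^-1 * tflip R^-1) * M = 1.
Proof.
split; first by rewrite mulrA mulrK ?Rmx_unit // -tflipM mulrV ?Rmx_unit // tflip1.
by rewrite mulrA -[_ * tflip R]mulrA -tflipM mulVr ?Rmx_unit // tflip1 mulr1 mulVr ?Rmx_unit.
Qed.

Lemma monodromy_comul b : Delta b * M = M * Delta b.
Proof.
have E : Delta b * tflip R = tflip R * tflip (Delta b).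
  by rewrite -[Delta b in LHS]tflipK -!tflipM tflip_comul.
by rewrite /monodromy mulrA E -!mulrA tflip_comul.
Qed.

(** Conjugation by R followed by the flip is an algebra automorphism; it fixes the image of Delta
    and the monodromy. *)
Lemma flip_conj_comul a : tflip (R * Delta a * R^-1) = Delta a.
Proof. by rewrite -tflip_comul mulrK ?Rmx_unit // tflipK. Qed.

Lemma flip_conj_monodromy : tflip (R * M * R^-1) = M.
Proof. by rewrite /monodromy mulrA mulrK ?Rmx_unit // tflipM tflipK. Qed.

Lemma conj_unitM (T : unitRingType) (r u v : T) : r \is a GRing.unit ->
  r * (u * v) * r^-1 = (r * u * r^-1) * (r * v * r^-1).
Proof. by move=> rU; rewrite !mulrA mulrVK. Qed.

Lemma flip_conj_comm (y : A \ox A) b : Delta b * y = y * Delta b ->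
  Delta b * tflip (R * y * R^-1) = tflip (R * y * R^-1) * Delta b.
Proof.
move=> yC; rewrite -{1 2}flip_conj_comul -!tflipM; congr tflip.
by rewrite -!conj_unitM ?Rmx_unit // yC.
Qed.

Lemma center_comm_tens z w (y : A \ox A) : z \in Z -> w \in Z -> (z \ox w) * y = y * (z \ox w).
Proof.
move=> /centerP zC /centerP wC; rewrite -[y]tens_sum.
rewrite (lin_tsum (g := fun t => _ * t)) ?(lin_tsum (g := fun t => t * _)); [|lin..].
by apply: eq_tsum => a b; rewrite !tprodM zC wC.
Qed.

(** The functional F of the sketch. *)
Definition lam2 (x : A \ox A) : k^o := \tsum_(a, b <- x) (lam a * lam b).

Lemma lam2_lin : lin lam2. Proof. by rewrite /lam2; lin. Qed.

Lemma lam2M (x y : A \ox A) : lam2 (x * y) = \tsum_(a, b <- x) \tsum_(c, d <- y) (lam (a * c) * lam (b * d)).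
Proof. by rewrite /lam2 tsum_mul //; lin. Qed.

Lemma muform_lam2 (x y : A \ox A) : muform lam x y = lam2 (x * y).
Proof. by rewrite lam2M. Qed.

Lemma lam2_tflip (x : A \ox A) : lam2 (tflip x) = lam2 x.
Proof. by rewrite /lam2 tsum_tflip; [apply: eq_tsum => a b; apply: mulrC|lin]. Qed.

(** By [lam_trace], moving R across costs the square of S on each leg, and S ⊗ S fixes R. *)
Lemma lam2_Rmx (x : A \ox A) : lam2 (x * R) = lam2 (R * x).
Proof.
rewrite !lam2M [RHS]tsum_exchange; apply: eq_tsum => a b.
rewrite -[RHS]sum_Rmx_antipode; last by lin.
rewrite -[RHS](sum_Rmx_antipode (f := fun c d => lam (S c * a) * lam (S d * b))); last by lin.
by apply: eq_tsum => c d; rewrite -!lam_trace.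
Qed.

(** As z ⊗ w commutes with R, [lam2_Rmx] makes conjugation by R invisible to F, and F is
    symmetric. *)
Lemma lam2_flip z w (y : A \ox A) : z \in Z -> w \in Z ->
  lam2 ((z \ox w) * y) = lam2 ((w \ox z) * tflip (R * y * R^-1)).
Proof.
move=> Zz Zw; rewrite -[w \ox z]tflipE -tflipM lam2_tflip.
rewrite !mulrA (center_comm_tens R Zz Zw) -!mulrA -lam2_Rmx.
by rewrite -!mulrA mulVr ?Rmx_unit // mulr1.
Qed.

Lemma lam2_comul_sym z w a : z \in Z -> w \in Z ->
  lam2 ((z \ox w) * Delta a) = lam2 ((w \ox z) * Delta a).
Proof. by move=> Zz Zw; rewrite lam2_flip // flip_conj_comul. Qed.

Lemma lam2_monodromy_sym z w : z \in Z -> w \in Z ->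
  lam2 ((z \ox w) * M) = lam2 ((w \ox z) * M).
Proof. by move=> Zz Zw; rewrite lam2_flip // flip_conj_monodromy. Qed.

Implicit Types (t : A \ox A).

(** * The centralizer of the coproduct *)

Lemma sum_C2 W (f : A -> A -> W) t b : t \in C2 H -> bilin f ->
  \tsum_(b1, b2 <- Delta b) \tsum_(a, c <- t) f (b1 * a) (b2 * c) =
  \tsum_(b1, b2 <- Delta b) \tsum_(a, c <- t) f (a * b1) (c * b2).
Proof.
by move=> /memC2 tC fB; rewrite [RHS]tsum_exchange -!tsum_mul // tC.
Qed.

Lemma C2_from_sum t :
    (forall b, \tsum_(b1, b2 <- Delta b) \tsum_(a, c <- t) ((b1 * a) \ox (b2 * c)) =
               \tsum_(b1, b2 <- Delta b) \tsum_(a, c <- t) ((a * b1) \ox (c * b2))) ->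
  t \in C2 H.
Proof.
move=> tC; apply/memC2 => b; rewrite -[LHS]tens_sum -[RHS]tens_sum.
rewrite !tsum_mul; [|lin..].
by rewrite tC tsum_exchange.
Qed.

Lemma C2M s t : s \in C2 H -> t \in C2 H -> s * t \in C2 H.
Proof. by move=> /memC2 sC /memC2 tC; apply/memC2 => b; rewrite mulrA sC -!mulrA tC. Qed.

Lemma C2_tens z w : z \in Z -> w \in Z -> z \ox w \in C2 H.
Proof. by move=> Zz Zw; apply/memC2 => b; rewrite (center_comm_tens _ Zz Zw). Qed.

Lemma C2_comul z : z \in Z -> Delta z \in C2 H.
Proof. by move=> /centerP zC; apply/memC2 => b; rewrite -!rmorphM zC. Qed.

Lemma C2_monodromy : monodromy \in C2 H.
Proof. by apply/memC2 => b; apply: monodromy_comul. Qed.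

Lemma C2_flip_conj t : t \in C2 H -> tflip (R * t * (R)^-1) \in C2 H.
Proof. by move=> /memC2 tC; apply/memC2 => b; apply: flip_conj_comm. Qed.

Lemma center1 : 1 \in Z. Proof. by apply/centerP => b; rewrite mul1r mulr1. Qed.

Lemma centerM z w : z \in Z -> w \in Z -> z * w \in Z.
Proof. by move=> /centerP zC /centerP wC; apply/centerP => b; rewrite -mulrA wC mulrA zC mulrA. Qed.

(** The bimodule property of ⋆ spreads b over three factors: one meets the central z, the other two
    pass through t. *)
Lemma C2_starl z t : z \in Z -> t \in C2 H ->
  \tsum_(a, c <- t) ((z ⋆ a) \ox c) \in C2 H.
Proof.
move=> /centerP zC tC; apply: C2_from_sum => b.
transitivity (\tsum_(b1, b2 <- Delta b) \tsum_(d1, d2 <- Delta b2)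
   \tsum_(a, c <- t) (((z * b1) ⋆ (a * d1)) \ox (c * d2))).
  transitivity (\tsum_(b1, b2 <- Delta b) \tsum_(d1, d2 <- Delta b2)
     \tsum_(a, c <- t) (((z * b1) ⋆ (d1 * a)) \ox (d2 * c))); last first.
    apply: eq_tsum => b1 b2.
    by rewrite (sum_C2 b2 (f := fun a c => ((z * b1) ⋆ a) \ox c)) //; lin.
  rewrite -(sum_comulA H (f := fun b1 d1 d2 =>
    \tsum_(a, c <- t) (((z * b1) ⋆ (d1 * a)) \ox (d2 * c)))); [|lin..].
  apply: eq_tsum => b1 b2; rewrite tsum_tens; last by lin.
  rewrite [RHS]tsum_exchange.
  apply: eq_tsum => a c; rewrite star_mull (lin_tsum (g := fun x => x \ox (b2 * c))); last by lin.
  by apply: eq_tsum => d1 d2; rewrite zC.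
rewrite -(sum_comulA H (f := fun b1 d1 d2 =>
  \tsum_(a, c <- t) (((z * b1) ⋆ (a * d1)) \ox (c * d2)))); [|lin..].
apply: eq_tsum => b1 b2; rewrite tsum_tens; last by lin.
rewrite tsum_exchange.
by apply: eq_tsum => a c; rewrite star_mulr (lin_tsum (g := fun x => x \ox (c * b2))) //; lin.
Qed.

Lemma C2_starr z t : z \in Z -> t \in C2 H ->
  \tsum_(a, c <- t) (a \ox (c ⋆ z)) \in C2 H.
Proof.
move=> /centerP zC tC; apply: C2_from_sum => b.
transitivity (\tsum_(b1, b2 <- Delta b) \tsum_(d1, d2 <- Delta b1)
   \tsum_(a, c <- t) ((a * d1) \ox ((c * d2) ⋆ (z * b2)))).
  transitivity (\tsum_(b1, b2 <- Delta b) \tsum_(d1, d2 <- Delta b1)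
     \tsum_(a, c <- t) ((d1 * a) \ox ((d2 * c) ⋆ (z * b2)))); last first.
    apply: eq_tsum => b1 b2.
    by rewrite (sum_C2 b1 (f := fun a c => a \ox (c ⋆ (z * b2)))) //; lin.
  rewrite (sum_comulA H (f := fun d1 d2 b2 =>
    \tsum_(a, c <- t) ((d1 * a) \ox ((d2 * c) ⋆ (z * b2))))); [|lin..].
  apply: eq_tsum => b1 b2; rewrite tsum_tens; last by lin.
  rewrite [RHS]tsum_exchange.
  apply: eq_tsum => a c; rewrite star_mull (lin_tsum (g := fun x => (b1 * a) \ox x)); last by lin.
  by apply: eq_tsum => d1 d2; rewrite zC.
rewrite (sum_comulA H (f := fun d1 d2 b2 =>
  \tsum_(a, c <- t) ((a * d1) \ox ((c * d2) ⋆ (z * b2))))); [|lin..].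
apply: eq_tsum => b1 b2; rewrite tsum_tens; last by lin.
rewrite tsum_exchange.
by apply: eq_tsum => a c; rewrite star_mulr (lin_tsum (g := fun x => (a * b1) \ox x)) //; lin.
Qed.

(** [merge] and [cokill] are Q and E of the sketch. *)
Definition merge t : A := \tsum_(a, c <- t) (a ⋆ c).
Definition cokill t : A := \tsum_(a, c <- t) (lam a *: c).
(* Integrating out the last leg requires the left integral [lam \o S] in order to
   land in the center ([kill_center]); [lam] only works for the first leg. *)
Definition kill t : A := \tsum_(a, c <- t) (lam (S c) *: a).

Lemma merge_center t : t \in C2 H -> merge t \in Z.
Proof.
move=> tC; apply/centerP => b; rewrite /merge.
rewrite (lin_tsum (g := fun x => x * b)) ?(lin_tsum (g := fun x => b * x)); [|lin..].
under eq_tsum do rewrite star_mulr; under [RHS]eq_tsum do rewrite star_mull.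
by rewrite [LHS]tsum_exchange [RHS]tsum_exchange -(sum_C2 b (f := star H lam)).
Qed.

Lemma center_1tens a : (1 : A) \ox a \in C2 H -> a \in Z.
Proof.
move=> /memC2 aC; apply/centerP => b.
have := congr1 (tsum (fun a c => eps a *: c)) (aC b).
rewrite !tsum_mul ?tsumE; [|lin..].
under eq_tsum => b1 b2 do (rewrite tsumE ?mulr1; last by lin).
rewrite (sum_counitl H b (f := fun x => x * a)) => [->|]; last by lin.
under eq_tsum do rewrite mul1r.
by rewrite (sum_counitl H b (f := fun x => a * x)) //; lin.
Qed.

Lemma center_tens1 a : a \ox (1 : A) \in C2 H -> a \in Z.
Proof.
move=> /memC2 aC; apply/centerP => b.
have := congr1 (tsum (fun a c => eps c *: a)) (aC b).
rewrite !tsum_mul ?tsumE; [|lin..].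
under eq_tsum => b1 b2 do (rewrite tsumE ?mulr1; last by lin).
rewrite (sum_counitr H b (f := fun x => x * a)) => [->|]; last by lin.
under eq_tsum do rewrite mul1r.
by rewrite (sum_counitr H b (f := fun x => a * x)) //; lin.
Qed.

Lemma cokill_center t : t \in C2 H -> cokill t \in Z.
Proof.
move=> tC; apply: center_1tens; move: (C2_starl center1 tC).
set u := tsum _ _; suff -> : u = (1 : A) \ox cokill t by [].
rewrite /u (lin_tsum (g := fun x => (1 : A) \ox x)); last by lin.
apply: eq_tsum => a c; rewrite star_1l.
by rewrite (linear_scale ((tprod_bilin A A).1 _)) (linear_scale ((tprod_bilin A A).2 _)).
Qed.

Lemma kill_center t : t \in C2 H -> kill t \in Z.
Proof.
move=> tC; apply: center_tens1; move: (C2_starr center1 tC).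
set u := tsum _ _; suff -> : u = kill t \ox (1 : A) by [].
rewrite /u (lin_tsum (g := fun x => x \ox (1 : A))); last by lin.
apply: eq_tsum => a c; rewrite star_1r.
by rewrite (linear_scale ((tprod_bilin A A).1 _)) (linear_scale ((tprod_bilin A A).2 _)).
Qed.

(** The same threefold distribution of b as in [C2_starl], now over [a1], [a2] and [c]. It supplies
    the element on which z is slid in [slidable_star]. *)
Lemma C2_split w t : w \in Z -> t \in C2 H ->
  \tsum_(a, c <- t) \tsum_(a1, a2 <- Delta a) (a1 \ox ((w * a2) ⋆ c)) \in C2 H.
Proof.
move=> /centerP wC tC; set u := tsum _ _.
have uE W (f : A -> A -> W) : bilin f -> tsum f u =
    \tsum_(a, c <- t) \tsum_(a1, a2 <- Delta a) f a1 ((w * a2) ⋆ c).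
  move=> fB; rewrite /u (lin_tsum (g := fun x => tsum f x)); last by lin.
  by apply: eq_tsum => a c; rewrite tsum_tens.
apply: C2_from_sum => b.
under eq_tsum => b1 b2 do (rewrite uE; last by lin).
under [RHS]eq_tsum => b1 b2 do (rewrite uE; last by lin).
pose h x y := \tsum_(a1, a2 <- Delta x) (a1 \ox ((w * a2) ⋆ y)).
have hB : bilin h by rewrite /h; lin.
transitivity (\tsum_(b1, b2 <- Delta b) \tsum_(a, c <- t) h (b1 * a) (b2 * c)).
  rewrite tsum_exchange [RHS]tsum_exchange; apply: eq_tsum => a c.
  rewrite /h; under [RHS]eq_tsum => b1 b2 do (rewrite sum_comulM; last by lin).
  rewrite (sum_comulA H (f := fun b1 b2 b3 => \tsum_(a1, a2 <- Delta a)
    ((b1 * a1) \ox ((w * (b2 * a2)) ⋆ (b3 * c))))); [|lin..].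
  apply: eq_tsum => b1 b2; rewrite [RHS]tsum_exchange; apply: eq_tsum => a1 a2.
  rewrite star_mull (lin_tsum (g := fun x => (b1 * a1) \ox x)); last by lin.
  by apply: eq_tsum => d1 d2; rewrite !mulrA wC.
rewrite sum_C2 // tsum_exchange [RHS]tsum_exchange; apply: eq_tsum => a c.
rewrite /h; under eq_tsum => b1 b2 do (rewrite sum_comulM; last by lin).
under eq_tsum => b1 b2 do rewrite tsum_exchange.
rewrite (sum_comulA H (f := fun b1 b2 b3 => \tsum_(a1, a2 <- Delta a)
    ((a1 * b1) \ox ((w * (a2 * b2)) ⋆ (c * b3))))); [|lin..].
apply: eq_tsum => b1 b2; rewrite tsum_exchange; apply: eq_tsum => a1 a2.
rewrite star_mulr (lin_tsum (g := fun x => (a1 * b1) \ox x)); last by lin.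
by apply: eq_tsum => d1 d2; rewrite !mulrA.
Qed.

Lemma lam2_comul_mul a t : lam2 (Delta a * t) = lam (a * merge t).
Proof.
rewrite lam2M tsum_exchange /merge (lin_tsum (g := fun x => lam (a * x))); last by lin.
by apply: eq_tsum => b c; rewrite lam_mul_star.
Qed.

Lemma lam2_1tens_mul a t : lam2 ((1 \ox a) * t) = lam (a * cokill t).
Proof.
rewrite lam2M tsumE; last by lin.
rewrite /cokill (lin_tsum (g := fun x => lam (a * x))); last by lin.
by apply: eq_tsum => b c; rewrite mul1r -scalerAr linearZ.
Qed.

(* [lam (S z)] and [lam z] are the values of [lam2] at [(z \ox 1) * Delta Lam] and
   [(1 \ox z) * Delta Lam]. *)
Lemma lam_antipode_center z : z \in Z -> lam (S z) = lam z.
Proof.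
move=> Zz; have Z1 := center1.
have E a b : lam2 ((a \ox b) * Delta Lam) =
    \tsum_(c, d <- Delta Lam) (lam (a * c) * lam (b * d)).
  by rewrite lam2M tsumE //; lin.
transitivity (lam2 ((z \ox 1) * Delta Lam)).
  rewrite E -lam_LamR (lin_tsum (g := lam)); last by lin.
  by apply: eq_tsum => c d; rewrite linearZ mul1r (centerP _ Zz).
rewrite lam2_comul_sym // E.
under eq_tsum => c d do rewrite mul1r.
have -> : \tsum_(c, d <- Delta Lam) (lam c * lam (z * d)) =
    lam (z * \tsum_(c, d <- Delta Lam) (lam c *: d)).
  rewrite (lin_tsum (g := fun x => lam (z * x))); last by lin.
  by apply: eq_tsum => c d; rewrite -scalerAr linearZ.
by rewrite intlam lamLam scale1r mulr1.
Qed.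

Lemma antipode_sqr_center z : z \in Z -> S (S z) = z.
Proof. by move=> /centerP zC; rewrite antipode_sqr -zC mulrK ?pivot_unit. Qed.

Lemma antipode_center z : z \in Z -> S z \in Z.
Proof.
move=> /centerP zC; apply/centerP => b.
by rewrite -[b](antipode_invK) -!antipodeM zC.
Qed.

(** F(t) is [lam] of the central element Q(t), where [lam] and [lam \o S] agree; the left integral
    [lam \o S] then splits the value at Q(t) over the two legs. *)
Lemma lam2_antipode t : t \in C2 H ->
  \tsum_(a, c <- t) (lam (S a) * lam (S c)) = lam2 t.
Proof.
move=> tC; transitivity (lam (merge t)); last first.
  by rewrite -[t in RHS]mul1r -(comul1 H) lam2_comul_mul mul1r.
rewrite -lam_antipode_center ?merge_center // /merge.
rewrite (lin_tsum (g := fun x => lam (S x))); last by lin.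
apply: eq_tsum => a c; rewrite /star (lin_tsum (g := fun x => lam (S x))); last by lin.
have := congr1 (fun x => lam (S a * x)) (lam_antipode_left c).
rewrite -scalerAr linearZ /= mulr1 => /esym; rewrite [X in X = _ -> _]mulrC => ->.
rewrite (lin_tsum (g := fun x => lam (S a * x))); last by lin.
by apply: eq_tsum => u v; rewrite !linearZ /= -scalerAr linearZ; apply: mulrC.
Qed.

(** * Sliding *)

(* Up to the symmetry of [lam2_flip], [slidable z] is the condition
   \hat\delta([z], [z]) = 0, with [(z \ox 1) * Delta z] in place of
   [(1 \ox z) * Delta z] ([slidable_delta]). *)
Definition slidable z := forall t, t \in C2 H ->
  lam2 ((z \ox z) * t) = lam2 ((z \ox 1) * (Delta z * t)).

Lemma lam2_tens_mul a b t :
  lam2 ((a \ox b) * t) = \tsum_(c, d <- t) (lam (a * c) * lam (b * d)).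
Proof. by rewrite lam2M tsumE //; lin. Qed.

Lemma cokill_tens_mul z t : cokill ((z \ox 1) * t) = \tsum_(a, c <- t) (lam (z * a) *: c).
Proof.
rewrite /cokill tsum_mul ?tsumE; [|lin..].
by apply: eq_tsum => a c; rewrite mul1r.
Qed.

Lemma merge_tens_mul z t : merge ((z \ox 1) * t) = \tsum_(a, c <- t) ((z * a) ⋆ c).
Proof.
rewrite /merge tsum_mul ?tsumE; [|lin..].
by apply: eq_tsum => a c; rewrite mul1r.
Qed.

Lemma star_center a b : a \in Z -> b \in Z -> a ⋆ b \in Z.
Proof.
move=> Za Zb; rewrite /star -cokill_tens_mul.
apply: cokill_center.
by rewrite C2M ?C2_tens ?C2_comul ?center1 ?antipode_center.
Qed.

Lemma lam_star_lam2 a b q : lam ((a ⋆ b) * q) = lam2 ((a \ox b) * Delta q).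
Proof. by rewrite lam_star_mul lam2_tens_mul. Qed.

Lemma lam_lam2_star a b q : lam (q * (a ⋆ b)) = lam2 ((S a \ox q) * Delta b).
Proof.
rewrite lam2_tens_mul /star (lin_tsum (g := fun x => lam (q * x))); last by lin.
by apply: eq_tsum => c d; rewrite -scalerAr linearZ.
Qed.

(** Commutativity of ⋆ under pairing with the center, hence in the quotient by the radical. *)
Lemma lam_starC a b q : a \in Z -> b \in Z -> q \in Z ->
  lam (q * (a ⋆ b)) = lam (q * (b ⋆ a)).
Proof.
move=> Za Zb /centerP qC; rewrite !qC !lam_star_lam2.
exact: lam2_comul_sym.
Qed.

(** Both sides are F((e ⊗ S(w)) Delta(z)). Starring by [S w] is thus adjoint to starring by [w],
    which isolates one factor of z ⋆ w. *)
Lemma lam_star_adj e z w : e \in Z -> z \in Z -> w \in Z ->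
  lam (e * (z ⋆ w)) = lam (z * (e ⋆ S w)).
Proof.
move=> Ze Zz Zw; rewrite lam_starC // lam_lam2_star.
rewrite lam2_comul_sym ?antipode_center //.
rewrite lam_mul_star lam2_tens_mul; apply: eq_tsum => c d.
by rewrite (centerP _ Ze) (centerP _ (antipode_center Zw)).
Qed.

(* With [v := z ⋆ w] and [e := merge ((v \ox 1) * t)], the right-hand side is
   [lam (v * e)]. By [lam_star_adj] it equals [lam (z * (e ⋆ S w))], which is again
   of the form [lam2 ((z \ox 1) * (Delta z * t1'))], so that [z] can be slid; since
   [z ⋆ w] and [w ⋆ z] agree on the center, the same can then be done with [w]. *)
Lemma slidable_star z w : z \in Z -> w \in Z ->
  slidable z -> slidable w -> slidable (z ⋆ w).
Proof.
move=> Zz Zw sz sw t tC; set v := z ⋆ w.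
have Zv : v \in Z by apply: star_center.
have Z1 := center1; have ZSz := antipode_center Zz; have ZSw := antipode_center Zw.
pose e := merge ((v \ox 1) * t).
have Ze : e \in Z by rewrite merge_center ?C2M ?C2_tens.
pose t1 := \tsum_(a, c <- t) (a \ox (c ⋆ S w)).
have t1C : t1 \in C2 H by apply: C2_starr.
(* Since (z ⋆ w) a is the sum of (z a1) ⋆ (w a2), merging [t1'] with z in its first leg gives
   [e ⋆ S w] ([eE]). *)
pose t1' := \tsum_(a, c <- t1) \tsum_(a1, a2 <- Delta a) (a1 \ox ((w * a2) ⋆ c)).
have t1'C : t1' \in C2 H by apply: C2_split.
(* Pairing z with the first half of Delta(a) produces S(z) ⋆ a, because S(S(z)) = z. *)
pose t2 := \tsum_(a, c <- t) ((S z ⋆ a) \ox c).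
have t2C : t2 \in C2 H by apply: C2_starl.
pose e2 := merge ((w \ox 1) * t2).
have Ze2 : e2 \in Z by rewrite merge_center ?C2M ?C2_tens.
pose t3 := \tsum_(a, c <- t2) (a \ox (c ⋆ S z)).
have t3C : t3 \in C2 H by apply: C2_starr.
pose e3 := cokill ((w \ox 1) * t2).
have Ze3 : e3 \in Z by rewrite cokill_center ?C2M ?C2_tens.
have sum1 W (f : A -> A -> W) : bilin f -> tsum f t1' =
    \tsum_(a, c <- t) \tsum_(a1, a2 <- Delta a) f a1 ((w * a2) ⋆ (c ⋆ S w)).
  move=> fB; rewrite /t1' (lin_tsum (g := fun x => tsum f x)); last by lin.
  rewrite tsum_tens; last by lin.
  by apply: eq_tsum => a c; rewrite tsum_tens.
have eE : e ⋆ S w = merge ((z \ox 1) * t1').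
  rewrite /e !merge_tens_mul sum1; last by lin.
  rewrite (lin_tsum (g := fun x => x ⋆ S w)); last by lin.
  apply: eq_tsum => a c; rewrite -starA star_mulr.
  rewrite (lin_tsum (g := fun x => x ⋆ (c ⋆ S w))); last by lin.
  by apply: eq_tsum => a1 a2; rewrite -starA.
have e2E : e2 ⋆ S z = merge ((w \ox 1) * t3).
  rewrite /e2 !merge_tens_mul /t3 [RHS]tsum_tens; last by lin.
  rewrite (lin_tsum (g := fun x => x ⋆ S z)); last by lin.
  by apply: eq_tsum => a c; rewrite -starA.
have Swap q : q \in Z -> lam (z * (q ⋆ S w)) = lam (w * (q ⋆ S z)).
  by move=> Zq; rewrite -!lam_star_adj // lam_starC.
transitivity (lam (z * (e ⋆ S w))); last first.
  rewrite -lam_star_adj // (centerP _ Ze) /e -lam2_comul_mul.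
  by rewrite !mulrA -(center_comm_tens _ Zv Z1).
rewrite eE -lam2_comul_mul mulrA -(center_comm_tens _ Zz Z1) -mulrA -sz //.
transitivity (lam (z * (e2 ⋆ S w))); last first.
  rewrite lam2_tens_mul sum1; last by lin.
  rewrite /e2 merge_tens_mul /t2 tsum_tens; last by lin.
  rewrite (lin_tsum (g := fun x => lam (z * (x ⋆ S w)))); last by lin.
  apply: eq_tsum => a c.
  have -> : S z ⋆ a = \tsum_(a1, a2 <- Delta a) (lam (z * a1) *: a2).
    by rewrite /star antipode_sqr_center.
  have gL : lin (fun x => lam (z * ((w * x) ⋆ c ⋆ S w))) by lin.
  rewrite (lin_tsum _ _ gL); apply: eq_tsum => a1 a2.
  by rewrite (linear_scale gL) -starA.
(* z has been slid. [Swap] exchanges z and w, and w is slid on [t3]. *)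
rewrite Swap // e2E -lam2_comul_mul mulrA -(center_comm_tens _ Zw Z1) -mulrA -sw //.
transitivity (lam (w * (e3 ⋆ S z))); last first.
  rewrite lam2_tens_mul /t3 tsum_tens; last by lin.
  rewrite /e3 cokill_tens_mul (lin_tsum (g := fun x => lam (w * (x ⋆ S z)))); last by lin.
  apply: eq_tsum => a c; rewrite (linear_scale (starB.1 _)) -scalerAr linearZ.
  by [].
(* Swapping back, lam(w (S(z) ⋆ a)) reassembles into lam((z ⋆ w) a). *)
rewrite -Swap // -lam_star_adj // /e3 cokill_tens_mul /t2 tsum_tens; last by lin.
rewrite lam2_tens_mul (lin_tsum (g := fun x => lam (x * v))); last by lin.
apply: eq_tsum => a c; rewrite -scalerAl linearZ -(centerP _ Zv).
rewrite lam_lam2_star antipode_sqr_center // lam_star_mul.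
by rewrite lam2_tens_mul.
Qed.

(** * The map J *)

Lemma sum_monodromy W (f : A -> A -> W) : bilin f ->
  \tsum_(p, q <- M) f p q = \tsum_(a, b <- R) \tsum_(c, d <- R) f (b * c) (a * d).
Proof. by move=> fB; rewrite /monodromy tsum_mul // tsum_tflip //; lin. Qed.

Lemma sum_monodromy_antipode W (f : A -> A -> W) : bilin f ->
  \tsum_(p, q <- M) f (S p) (S q) = \tsum_(p, q <- M) f q p.
Proof.
move=> fB; rewrite !sum_monodromy; [|lin..].
under eq_tsum => a b do under eq_tsum => c d do rewrite !antipodeM.
under eq_tsum => a b do
  (rewrite (sum_Rmx_antipode (f := fun c d => f (c * S b) (d * S a))); last by lin).
rewrite (sum_Rmx_antipode (f := fun a b => \tsum_(c, d <- R) f (c * b) (d * a))); last by lin.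
exact: tsum_exchange.
Qed.

(** In leg notation (1 ⊗ Delta)M = R_21 M_13 R_12; likewise [sum_monodromy_comull] is (Delta ⊗ 1)M =
    R_32 M_13 R_23. *)
Lemma sum_monodromy_comulr W (f : A -> A -> A -> W) :
    (forall v w, lin (fun u => f u v w)) -> (forall u w, lin (fun v => f u v w)) ->
    (forall u v, lin (f u v)) ->
  \tsum_(p, q <- M) \tsum_(q1, q2 <- Delta q) f p q1 q2 =
  \tsum_(a, b <- R) \tsum_(a', b' <- R) \tsum_(c, d <- R) \tsum_(c', d' <- R)
    f (b * b' * (c * c')) (a * d') (a' * d).
Proof.
move=> f1 f2 f3; rewrite sum_monodromy; last by lin.
rewrite -(sum_Rmx_comull (f := fun a a' bb => \tsum_(c, d <- R) \tsum_(c', d' <- R)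
    f (bb * (c * c')) (a * d') (a' * d))); [|lin..].
apply: eq_tsum => a b; under eq_tsum => c d do (rewrite sum_comulM; last by lin).
rewrite tsum_exchange; apply: eq_tsum => a1 a2.
by rewrite (sum_Rmx_comulr (f := fun c d1 d2 => f (b * c) (a1 * d1) (a2 * d2))); [|lin..].
Qed.

Lemma sum_monodromy_comull W (f : A -> A -> A -> W) :
    (forall v w, lin (fun u => f u v w)) -> (forall u w, lin (fun v => f u v w)) ->
    (forall u v, lin (f u v)) ->
  \tsum_(p, q <- M) \tsum_(p1, p2 <- Delta p) f p1 p2 q =
  \tsum_(a, b <- R) \tsum_(a', b' <- R) \tsum_(c, d <- R) \tsum_(c', d' <- R)
    f (b' * c) (b * c') (a * a' * (d * d')).
Proof.
move=> f1 f2 f3; rewrite sum_monodromy; last by lin.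
rewrite -(sum_Rmx_comulr (f := fun aa b' b => \tsum_(c, d <- R) \tsum_(c', d' <- R)
    f (b' * c) (b * c') (aa * (d * d')))); [|lin..].
apply: eq_tsum => a b; under eq_tsum => c d do (rewrite sum_comulM; last by lin).
rewrite tsum_exchange; apply: eq_tsum => b1 b2.
by rewrite (sum_Rmx_comull (f := fun c1 c2 d => f (b1 * c1) (b2 * c2) (a * d))); [|lin..].
Qed.

Lemma JmapE z : Jmap H lam z = cokill ((z \ox 1) * M).
Proof.
rewrite cokill_tens_mul sum_monodromy; last by lin.
by apply: eq_tsum => a b; apply: eq_tsum => c d; rewrite !mulrA.
Qed.

#[local] Hint Resolve center1 C2_monodromy : core.

Lemma C2_tens_mul z w t : z \in Z -> w \in Z -> t \in C2 H -> (z \ox w) * t \in C2 H.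
Proof. by move=> Zz Zw tC; apply: C2M => //; apply: C2_tens. Qed.

Lemma Jmap_center z : z \in Z -> Jmap H lam z \in Z.
Proof. by move=> Zz; rewrite JmapE; apply/cokill_center/C2_tens_mul. Qed.

Lemma lam_Jmap c z : lam (c * Jmap H lam z) = lam2 ((z \ox c) * M).
Proof.
rewrite JmapE cokill_tens_mul lam2_tens_mul (lin_tsum (g := fun x => lam (c * x))); last by lin.
by apply: eq_tsum => p q; rewrite -scalerAr linearZ.
Qed.

(* [Jmap] integrates the first leg of [M]. The slide below needs the second leg
   integrated instead; by [lam_Jdual] this gives the same class. *)
Definition Jdual z : A := \tsum_(p, q <- M) (lam (S (z * q)) *: p).
Local Notation J' := Jdual.

Lemma Jdual_center z : z \in Z -> J' z \in Z.
Proof.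
move=> Zz; suff -> : J' z = kill ((1 \ox z) * M).
  exact/kill_center/C2_tens_mul.
rewrite /kill tsum_mul ?tsumE; [|lin..].
by apply: eq_tsum => p q; rewrite mul1r.
Qed.

Lemma lam_Jdual e z : e \in Z -> z \in Z -> lam (e * J' z) = lam (e * Jmap H lam z).
Proof.
move=> Ze Zz; have Z1 := center1.
rewrite lam_Jmap lam2_monodromy_sym // lam2_tens_mul.
have EC : cokill ((e \ox 1) * M) \in Z by exact/cokill_center/C2_tens_mul.
transitivity (lam (S (z * cokill ((e \ox 1) * M)))).
  rewrite cokill_tens_mul (lin_tsum (g := fun x => lam (S (z * x)))); last by lin.
  rewrite (lin_tsum (g := fun x => lam (e * x))); last by lin.
  by apply: eq_tsum => p q; rewrite -!scalerAr !linearZ; apply: mulrC.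
rewrite lam_antipode_center ?centerM // cokill_tens_mul.
rewrite (lin_tsum (g := fun x => lam (z * x))); last by lin.
by apply: eq_tsum => p q; rewrite -scalerAr linearZ.
Qed.

Local Notation N := (R^-1 * tflip R^-1).

(** In R_21 M_13 R_12, integrating the third leg against z turns M_13 into J'(z), which is central
    and comes out in front of R_21 R_12 = M. *)
Lemma sum_monodromy_factorr W (g : A -> A -> W) z : z \in Z -> bilin g ->
  \tsum_(p, q <- M) \tsum_(q1, q2 <- Delta q) (lam (S (z * q2)) *: g p q1) =
  \tsum_(p, q <- M) g (J' z * p) q.
Proof.
move=> Zz gB; rewrite (sum_monodromy_comulr (f := fun p q1 q2 => lam (S (z * q2)) *: g p q1)); [|lin..].
rewrite sum_monodromy; last by lin.
apply: eq_tsum => a b.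
under eq_tsum => a' b' do rewrite tsum_exchange.
rewrite tsum_exchange; apply: eq_tsum => c' d'.
transitivity (g (b * J' z * c') (a * d')); last by rewrite -(centerP _ (Jdual_center Zz)) !mulrA.
rewrite /Jdual sum_monodromy; last by lin.
have gL : lin (fun x => g (b * x * c') (a * d')) by lin.
rewrite (lin_tsum _ _ gL); apply: eq_tsum => a' b'.
rewrite (lin_tsum _ _ gL); apply: eq_tsum => c d.
by rewrite (linear_scale gL) !mulrA.
Qed.

(** (Delta ⊗ 1)M times M^-1 in the last two legs is R_32 M_13 R_32^-1. Under [lam \o S] the last
    factor passes around by [lam_trace] and cancels R_32. *)
Lemma sum_monodromy_factorl W (g : A -> A -> W) z : z \in Z -> bilin g ->
  \tsum_(u, v <- N) \tsum_(p, q <- M) \tsum_(p1, p2 <- Delta p)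
     (lam (S (z * (q * v))) *: g p1 (p2 * u)) = g (J' z) 1.
Proof.
move=> Zz gB; have ZSz := antipode_center Zz.
pose F b u x := \tsum_(a', b' <- R) \tsum_(c, d <- R)
  (lam (S (a' * d) * x * S z) *: g (b' * c) (b * u)).
transitivity (\tsum_(a, b <- R) \tsum_(v, u <- R) F b u (S a * v)); last first.
  transitivity (\tsum_(v, u <- (1 : A \ox A)) F 1 u v).
    rewrite -(mulVr Rmx_unit) Rmx_inv tsum_mul; last by rewrite /F; lin.
    rewrite tsum_tens; last by rewrite /F; lin.
    by apply: eq_tsum => a b; apply: eq_tsum => v u; rewrite /F;
       do 2![apply: eq_tsum => ? ?]; rewrite mul1r.
  rewrite tsum1; last by rewrite /F; lin.
  rewrite /F /Jdual sum_monodromy; last by lin.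
  have gL : lin (fun x => g x 1) by lin.
  rewrite (lin_tsum _ _ gL); apply: eq_tsum => a' b'.
  rewrite (lin_tsum _ _ gL); apply: eq_tsum => c d.
  by rewrite (linear_scale gL) !mulr1 -antipodeM.
under eq_tsum => u v do (rewrite (sum_monodromy_comull
   (f := fun p1 p2 q => lam (S (z * (q * v))) *: g p1 (p2 * u))); [|lin..]).
rewrite tsum_exchange; apply: eq_tsum => a b.
rewrite tsum_exchange /F [RHS]tsum_exchange; apply: eq_tsum => a' b'.
rewrite tsum_exchange [RHS]tsum_exchange; apply: eq_tsum => c d.
pose h u v := lam (S (z * (a * a' * (d * v)))) *: g (b' * c) (b * u).
have hB : bilin h by rewrite /h; lin.
transitivity (\tsum_(u, v <- R * N) h u v).
  rewrite [RHS]tsum_mul; last by lin.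
  rewrite [RHS]tsum_exchange; apply: eq_tsum => u v.
  by apply: eq_tsum => c' d'; rewrite /h !mulrA.
rewrite mulrA mulrV ?Rmx_unit // mul1r tsum_tflip; last by lin.
rewrite Rmx_inv tsum_tens; last by lin.
apply: eq_tsum => v u; rewrite /h; congr (_ *: _).
by rewrite !antipodeM -!mulrA -lam_trace -!mulrA (centerP _ ZSz).
Qed.

Lemma C2_monodromy_inv : N \in C2 H.
Proof.
have [MN NM] := monodromy_inv; apply/memC2 => b.
have E : M * (Delta b * N) = Delta b by rewrite mulrA -monodromy_comul -mulrA MN mulr1.
by rewrite -[LHS]mul1r -NM -(mulrA N M) E.
Qed.

(** * Sliding J(z) by means of four linked strands *)

Section JDualSlide.
Variables (z : A) (t : A \ox A).
Hypotheses (Zz : z \in Z) (tC : t \in C2 H).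

(** [em] closes the first two strands with t, with a on the second; [Jt] links the result to the
    third strand by M. For arbitrary a, the adjoint action below replaces centrality. *)
Let em a : A := \tsum_(x, y <- t) (x ⋆ (a * y)).
Let Jt e : A := \tsum_(p, q <- M) (lam (p * e) *: q).
Let Hm a : A := Jt (em a).

Let emL : lin em. Proof. by rewrite /em; lin. Qed.

Let JtL : lin Jt. Proof. by rewrite /Jt; lin. Qed.

Let HmL : lin Hm. Proof. by rewrite /Hm; lin. Qed.

Let emE a : em a = merge ((1 \ox a) * t).
Proof.
rewrite /merge tsum_mul ?tsumE; [|lin..].
by apply: eq_tsum => x y; rewrite mul1r.
Qed.

(** [em] commutes with the adjoint action of b, sending a to the sum of b2 a S^-1(b1):
    Delta(S^-1(b1)) passes through t, b2 enters by [star_mull], and the factors meeting on the first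
    leg cancel. *)
Let em_adj a b : \tsum_(b1, b2 <- Delta b) (b2 * em a * Si b1) =
  \tsum_(b1, b2 <- Delta b) em (b2 * a * Si b1).
Proof.
pose G b1 v d1 d2 := \tsum_(x, y <- t) ((d1 * (Si v * x)) ⋆ (d2 * (a * (Si b1 * y)))).
transitivity (\tsum_(b1, b2 <- Delta b) \tsum_(c1, c2 <- Delta b1) \tsum_(d1, d2 <- Delta b2)
   G c1 c2 d1 d2).
  apply: eq_tsum => b1 b2; rewrite -mulrA.
  have -> : em a * Si b1 = \tsum_(c1, c2 <- Delta b1) \tsum_(x, y <- t)
      ((Si c2 * x) ⋆ (a * (Si c1 * y))).
    have := sum_C2 (Si b1) (f := fun x y => x ⋆ (a * y)) tC.
    rewrite comul_antipode_inv !tsum_tens; [|lin..].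
    move=> ->; last by lin.
    rewrite /em (lin_tsum (g := fun x => x * Si b1)); last by lin.
    rewrite [RHS]tsum_exchange; apply: eq_tsum => x y.
    rewrite star_mulr comul_antipode_inv tsum_tens; last by lin.
    by apply: eq_tsum => c1 c2; rewrite mulrA.
  rewrite (lin_tsum (g := fun x => b2 * x)); last by lin.
  apply: eq_tsum => c1 c2; rewrite (lin_tsum (g := fun x => b2 * x)); last by lin.
  rewrite /G [RHS]tsum_exchange; apply: eq_tsum => x y; exact: star_mull.
rewrite (sum_comulA H (f := fun c1 c2 b2 => \tsum_(d1, d2 <- Delta b2) G c1 c2 d1 d2));
  [|rewrite /G; lin..].
apply: eq_tsum => b1 b2.
rewrite -(sum_comulA H (f := G b1)); [|rewrite /G; lin..].
rewrite (_ : em _ = \tsum_(x, y <- t) ((1 * x) ⋆ (b2 * (a * (Si b1 * y))))); last first.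
  by apply: eq_tsum => x y; rewrite mul1r !mulrA.
rewrite -(sum_antipode_invrl b2 (f := fun u v => \tsum_(x, y <- t) ((u * x) ⋆ (v * (a * (Si b1 * y)))))); last by lin.
by apply: eq_tsum => v d2; apply: eq_tsum => v1 d1; apply: eq_tsum => x y; rewrite mulrA.
Qed.

(** Insert S(b1) b2 before the first leg of M, let the coproduct pass through M, and carry the
    leftover S(b1) around [lam]. *)
Let Jt_adj e b : b * Jt e = \tsum_(b1, b2 <- Delta b) \tsum_(b3, b4 <- Delta b2)
  (Jt (b3 * e * Si b1) * b4).
Proof.
pose F u v := \tsum_(p, q <- M) (lam (u * (p * e)) *: (v * q)).
have FB : bilin F by rewrite /F; lin.
transitivity (F 1 b).
  rewrite /Jt (lin_tsum (g := fun x => b * x)); last by lin.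
  by apply: eq_tsum => p q; rewrite mul1r scalerAr.
rewrite -(sum_antipodell H b FB).
rewrite (sum_comulA H (f := fun b1 b3 b4 => F (S b1 * b3) b4)); [|lin..].
apply: eq_tsum => b1 b2.
transitivity (\tsum_(b3, b4 <- Delta b2) \tsum_(p, q <- M)
   (lam (S b1 * (b3 * p * e)) *: (b4 * q))).
  by rewrite /F; do 2![apply: eq_tsum => ? ?]; rewrite !mulrA.
rewrite (sum_C2 b2 (f := fun p q => lam (S b1 * (p * e)) *: q)) ?C2_monodromy //; last by lin.
apply: eq_tsum => b3 b4; rewrite /Jt (lin_tsum (g := fun x => x * b4)); last by lin.
apply: eq_tsum => p q; rewrite -scalerAl; congr (_ *: _).
by rewrite [in RHS]mulrA lam_trace antipode_invK !mulrA.
Qed.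

Let Hm_adj a b : b * Hm a = \tsum_(b1, b2 <- Delta b) \tsum_(b3, b4 <- Delta b2)
  (Hm (b3 * a * Si b1) * b4).
Proof.
rewrite /Hm Jt_adj -(sum_comulA H (f := fun b1 b3 b4 => Jt (b3 * em a * Si b1) * b4)); [|lin..].
rewrite -(sum_comulA H (f := fun b1 b3 b4 => Jt (em (b3 * a * Si b1)) * b4)); [|lin..].
apply: eq_tsum => b1 b2.
have gL : lin (fun x => Jt x * b2) by lin.
by rewrite -(lin_tsum _ _ gL) em_adj (lin_tsum _ _ gL).
Qed.

(* [Wt] interpolates between the two sides of [Jdual_slide]: these are the values
   of [lam2] at [(z \ox z) * Wt] and at [(z \ox 1) * Delta z * Wt]. *)
Let Wt : A \ox A := \tsum_(u, v <- N) \tsum_(x, x' <- M) \tsum_(x1, x2 <- Delta x')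
  ((Hm (u * x) * v * x1) \ox x2).

Let sumW W (f : A -> A -> W) : bilin f -> tsum f Wt =
  \tsum_(u, v <- N) \tsum_(x, x' <- M) \tsum_(x1, x2 <- Delta x') f (Hm (u * x) * v * x1) x2.
Proof.
move=> fB; rewrite /Wt (lin_tsum (g := fun x => tsum f x)); last by lin.
apply: eq_tsum => u v; rewrite (lin_tsum (g := fun x => tsum f x)); last by lin.
by apply: eq_tsum => x x'; rewrite tsum_tens.
Qed.

(* The four factors of the iterated coproduct of [b] meet [Hm (u * x)] on both
   sides, [v] and [x2]; they are moved to the right one pair of legs at a time. *)
Let W_C2 : Wt \in C2 H.
Proof.
apply: C2_from_sum => b.
under eq_tsum => b1 b2 do (rewrite sumW; last by lin).
under [RHS]eq_tsum => b1 b2 do (rewrite sumW; last by lin).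
pose P0 c1 c3 c4 b2 := \tsum_(u, v <- N) \tsum_(x, x' <- M) \tsum_(x1, x2 <- Delta x')
   ((Hm (c3 * u * x * Si c1) * (c4 * v * x1)) \ox (b2 * x2)).
pose P c1 c3 c4 b2 := \tsum_(u, v <- N) \tsum_(x, x' <- M) \tsum_(x1, x2 <- Delta x')
   ((Hm (u * c3 * x * Si c1) * (v * c4 * x1)) \ox (b2 * x2)).
pose Q c r := \tsum_(u, v <- N) \tsum_(x, x' <- M) \tsum_(x1, x2 <- Delta (x' * r))
   ((Hm (u * x * c) * (v * x1)) \ox x2).
have QB : bilin Q by rewrite /Q; lin.
have P1L c3 c4 b2 : lin (fun c1 => P c1 c3 c4 b2) by rewrite /P; lin.
have P3L c1 c4 b2 : lin (fun c3 => P c1 c3 c4 b2) by rewrite /P; lin.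
have P4L c1 c3 b2 : lin (fun c4 => P c1 c3 c4 b2) by rewrite /P; lin.
have PbL c1 c3 c4 : lin (P c1 c3 c4) by rewrite /P; lin.
transitivity (\tsum_(b1, b2 <- Delta b) \tsum_(c1, c2 <- Delta b1)
    \tsum_(c3, c4 <- Delta c2) P0 c1 c3 c4 b2).
  apply: eq_tsum => b1 b2; rewrite /P0.
  under [RHS]eq_tsum => c1 c2 do rewrite tsum_exchange.
  rewrite [RHS]tsum_exchange; apply: eq_tsum => u v.
  under [RHS]eq_tsum => c1 c2 do rewrite tsum_exchange.
  rewrite [RHS]tsum_exchange; apply: eq_tsum => x x'.
  under [RHS]eq_tsum => c1 c2 do rewrite tsum_exchange.
  rewrite [RHS]tsum_exchange; apply: eq_tsum => x1 x2.
  rewrite !mulrA Hm_adj.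
  have gL : lin (fun y => (y * v * x1) \ox (b2 * x2)) by lin.
  rewrite (lin_tsum _ _ gL); apply: eq_tsum => c1 c2.
  by rewrite (lin_tsum _ _ gL); apply: eq_tsum => c3 c4; rewrite !mulrA.
transitivity (\tsum_(c1, b' <- Delta b) \tsum_(c3, r <- Delta b')
    \tsum_(c4, b2 <- Delta r) P c1 c3 c4 b2).
  transitivity (\tsum_(b1, b2 <- Delta b) \tsum_(c1, c2 <- Delta b1)
      \tsum_(c3, c4 <- Delta c2) P c1 c3 c4 b2).
    apply: eq_tsum => b1 b2; apply: eq_tsum => c1 c2.
    exact: (sum_C2 c2 (f := fun u v => \tsum_(x, x' <- M) \tsum_(x1, x2 <- Delta x')
      ((Hm (u * x * Si c1) * (v * x1)) \ox (b2 * x2))) C2_monodromy_inv ltac:(lin)).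
  rewrite (sum_comulA H (f := fun c1 c2 b2 => \tsum_(c3, c4 <- Delta c2) P c1 c3 c4 b2));
    [|lin..].
  apply: eq_tsum => c1 b'.
  by rewrite (sum_comulA H (f := fun c3 c4 b2 => P c1 c3 c4 b2)); [|lin..].
transitivity (\tsum_(c1, b' <- Delta b) \tsum_(c3, r <- Delta b') Q (c3 * Si c1) r).
  apply: eq_tsum => c1 b'.
  pose f u v x x' := \tsum_(x1, x2 <- Delta x') ((Hm (u * x * Si c1) * (v * x1)) \ox x2).
  transitivity (\tsum_(u, v <- N) \tsum_(c3, r <- Delta b') \tsum_(x, x' <- M)
     f u v (c3 * x) (r * x')).
    rewrite tsum_exchange; apply: eq_tsum => c3 r.
    rewrite /P tsum_exchange; apply: eq_tsum => u v.
    rewrite tsum_exchange; apply: eq_tsum => x x'.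
    rewrite /f sum_comulM; last by lin.
    by do 2![apply: eq_tsum => ? ?]; rewrite !mulrA.
  rewrite [RHS]tsum_exchange; apply: eq_tsum => u v.
  have fB : bilin (f u v) by rewrite /f; lin.
  rewrite (sum_C2 b' C2_monodromy fB).
  by do 2![apply: eq_tsum => ? ?]; rewrite /f !mulrA.
(* b has passed N and M; the conjugating pair now meets inside [Hm] and cancels. *)
rewrite -(sum_comulA H (f := fun c1 c3 r => Q (c3 * Si c1) r)); [|lin..].
rewrite (sum_antipode_invrl b QB) /Q.
rewrite [RHS]tsum_exchange; apply: eq_tsum => u v.
rewrite [RHS]tsum_exchange; apply: eq_tsum => x x'.
rewrite sum_comulM; last by lin.
rewrite [RHS]tsum_exchange; apply: eq_tsum => x1 x2; apply: eq_tsum => b1 b2.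
by rewrite mulr1 !mulrA.
Qed.

Let j := J' z.

Lemma Jdual_slide : slidable z ->
  lam2 ((1 \ox j) * (Delta j * t)) = lam2 ((j \ox j) * t).
Proof.
move=> sz; have Zj : j \in Z := Jdual_center Zz.
have Ze : em j \in Z by rewrite emE; exact/merge_center/C2_tens_mul.
(* Expand the outer factor j of lam(j em(j)) by its definition. *)
transitivity (lam (S (z * Hm j))).
  rewrite mulrA (center_comm_tens _ center1 Zj) -mulrA lam2_comul_mul -emE -(centerP _ Ze).
  rewrite /j /Jdual (lin_tsum (g := fun x => lam (em j * x))); last by lin.
  rewrite /Hm /Jt (lin_tsum (g := fun x => lam (S (z * x)))); last by lin.
  apply: eq_tsum => p q; rewrite -!scalerAr !linearZ (centerP _ Ze).
  exact: mulrC.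
(* Insert 1 = N M; [sum_monodromy_factorr] absorbs j into M at the cost of a fourth strand
   integrated against z. *)
transitivity (\tsum_(a, c <- (z \ox z) * Wt) (lam (S a) * lam (S c))).
  pose h a c := lam (S (z * (Hm (j * a) * c))).
  transitivity (tsum h 1); first by rewrite tsum1 /h ?mulr1 //; lin.
  rewrite -(monodromy_inv.2) tsum_mul; last by rewrite /h; lin.
  rewrite tsum_mul ?tsumE ?sumW; [|lin..].
  apply: eq_tsum => u v; rewrite /h.
  pose g p q : k^o := lam (S (z * (Hm (u * p) * v * q))).
  transitivity (\tsum_(p, q <- M) g (j * p) q).
    by apply: eq_tsum => p q; rewrite /g !mulrA (centerP _ Zj).
  rewrite -sum_monodromy_factorr //; last by rewrite /g; lin.
  by apply: eq_tsum => p q; apply: eq_tsum => q1 q2; apply: mulrC.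
(* On C2, [lam \o S] can be traded for [lam], where z slides, and back; in between Delta(z) moves to
   the right of [Wt]. *)
rewrite lam2_antipode ?C2_tens_mul // sz //.
have -> : Delta z * Wt = Wt * Delta z by move/memC2: W_C2.
rewrite -lam2_antipode; last exact/C2_tens_mul/C2M/C2_comul.
rewrite tsum_mul ?tsumE; [|lin..].
rewrite tsum_mul ?sumW; [|lin..].
pose g a c : k^o := \tsum_(x, y <- t) (lam (a * x) * lam (c * (j * y))).
have gB : bilin g by rewrite /g; lin.
transitivity (g j 1); last first.
  by rewrite lam2_tens_mul; apply: eq_tsum => x y; rewrite mul1r.
rewrite -sum_monodromy_factorl //; apply: eq_tsum => u v.
transitivity (lam (S (z * (Hm (u * j) * v)))).
  have gL : lin (fun x => lam (S (z * (Hm (u * x) * v)))) by lin.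
  rewrite /j /Jdual (lin_tsum _ _ gL); apply: eq_tsum => x x'.
  rewrite (linear_scale gL) (centerP _ Zz).
  have hL : lin (fun y => lam (S (z * (Hm (u * x) * v * y)))) by lin.
  transitivity (lam (S (z * (Hm (u * x) * v * (lam (S (x' * z)) *: 1))))); last first.
    by rewrite (linear_scale hL) mulr1.
  (* The left integral [lam \o S] contracts the coproduct of x' z over the last two strands. *)
  rewrite -lam_antipode_left (lin_tsum _ _ hL) sum_comulM; last by lin.
  do 2![apply: eq_tsum => ? ?]; rewrite (linear_scale hL) mul1r !mulrA.
  exact: mulrC.
have gL : lin (fun x => lam (S (z * (x * v)))) by lin.
rewrite /Hm /Jt (lin_tsum _ _ gL); apply: eq_tsum => p q.
rewrite (linear_scale gL) [LHS]mulrC.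
have sL : lin (fun x : k^o => lam (S (z * (q * v))) *: x) by lin.
rewrite -(lin_tsum _ _ sL).
congr (_ *: _); rewrite /em (lin_tsum (g := fun x => lam (p * x))); last by lin.
rewrite /g [RHS]tsum_exchange; apply: eq_tsum => x y; rewrite lam_mul_star.
by apply: eq_tsum => p1 p2; rewrite !mulrA.
Qed.

End JDualSlide.
(** * The quotient by the radical *)

Local Notation K := (KA lam).

Lemma KA_center z : z \in K -> z \in Z. Proof. by case/memKA. Qed.

Lemma KA_from_lam z : z \in Z -> (forall c, c \in Z -> lam (c * z) = 0) -> z \in K.
Proof. by move=> Zz z0; apply/memKA; split=> // c Zc; rewrite (centerP _ Zz) z0. Qed.

Lemma lam_KA z w : z \in K -> w \in Z -> lam (z * w) = 0.
Proof. by case/memKA=> _ z0 /z0. Qed.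

(** The pairing is with the central E(t). This and the two variants below make all the maps descend
    to the quotient. *)
Lemma lam2_KAr z t : z \in K -> t \in C2 H -> lam2 ((1 \ox z) * t) = 0.
Proof. by move=> Kz tC; rewrite lam2_1tens_mul lam_KA ?cokill_center. Qed.

Lemma lam2_KAl z t : z \in K -> t \in C2 H -> lam2 ((z \ox 1) * t) = 0.
Proof.
move=> Kz tC; rewrite lam2_flip //; last exact: KA_center.
by apply: lam2_KAr => //; apply: C2_flip_conj.
Qed.

Lemma lam2_KA_comul z t : z \in K -> t \in C2 H -> lam2 (Delta z * t) = 0.
Proof. by move=> Kz tC; rewrite lam2_comul_mul lam_KA ?merge_center. Qed.

Lemma hatcl_eq z w : z \in Z -> w \in Z -> z - w \in K -> hatcl lam z = hatcl lam w.
Proof. by move=> Zz Zw Kzw; apply/eqP; rewrite eq_vclass. Qed.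

Lemma hatcl_eq_lam z w : z \in Z -> w \in Z ->
  (forall c, c \in Z -> lam (c * z) = lam (c * w)) -> hatcl lam z = hatcl lam w.
Proof.
move=> Zz Zw zw; apply: hatcl_eq => //; apply: KA_from_lam; first exact: rpredB.
by move=> c Zc; rewrite mulrBr linearB /= zw // subrr.
Qed.

Lemma hatcl_ex (x : hatZ lam) : exists2 z, z \in Z & x = hatcl lam z.
Proof. by exists (vrepr x); [apply: vrepr_mem|rewrite /hatcl vreprK]. Qed.

Lemma lam2B (s t : A \ox A) : lam2 (s - t) = lam2 s - lam2 t.
Proof. exact: (linB _ _ lam2_lin). Qed.

Lemma tens_mul1l a b : (a \ox b : A \ox A) = (a \ox 1) * (1 \ox b).
Proof. by rewrite tprodM mulr1 mul1r. Qed.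

Lemma tens_mul1r a b : (a \ox b : A \ox A) = (1 \ox b) * (a \ox 1).
Proof. by rewrite tprodM mulr1 mul1r. Qed.

Lemma hatSE z : z \in Z -> hatS H (hatcl lam z) = hatcl lam (S z).
Proof.
apply: vmap1E => [w Zw|u v Zu Zv Kuv]; first exact: antipode_center.
rewrite -linearB; apply: KA_from_lam => [|c Zc].
  exact/antipode_center/KA_center.
rewrite -(antipode_sqr_center Zc) -antipodeM lam_antipode_center.
  by rewrite lam_KA // antipode_center.
by apply: centerM; [apply: KA_center|apply: antipode_center].
Qed.

Lemma hatstarE a b : a \in Z -> b \in Z ->
  hatstar H lam (hatcl lam a) (hatcl lam b) = hatcl lam (a ⋆ b).
Proof.
have sub0 u v w c : w \in Z -> c \in Z -> u - v \in K ->
    lam2 (((u - v) \ox w) * Delta c) = 0.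
  move=> Zw Zc Kuv; rewrite tens_mul1l -mulrA lam2_KAl //.
  exact/C2_tens_mul/C2_comul.
apply: vmap2E => [|u v w Zu Zv Zw Kuv|u v w Zu Zv Zw Kuv]; first exact: star_center.
  have -> : u ⋆ w - v ⋆ w = (u - v) ⋆ w.
    by rewrite (linB _ _ (starB.1 w)).
  apply: KA_from_lam => [|c Zc]; first exact/star_center/Zw/KA_center.
  by rewrite (centerP _ Zc) lam_star_lam2 sub0.
have -> : w ⋆ u - w ⋆ v = w ⋆ (u - v).
  by rewrite (linB _ _ (starB.2 w)).
have Zuv := KA_center Kuv.
apply: KA_from_lam => [|c Zc]; first exact: star_center.
by rewrite lam_starC // (centerP _ Zc) lam_star_lam2 sub0.
Qed.

Lemma hatJE z : z \in Z -> hatJ H lam (hatcl lam z) = hatcl lam (Jmap H lam z).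
Proof.
apply: vmap1E => [w Zw|u v Zu Zv Kuv]; first exact: Jmap_center.
have JL : lin (Jmap H lam).
  by move=> c x y; rewrite /Jmap; move: c x y; apply: (_ : lin _); lin.
have -> : Jmap H lam u - Jmap H lam v = Jmap H lam (u - v).
  by rewrite (linB _ _ JL).
apply: KA_from_lam => [|c Zc]; first exact/Jmap_center/KA_center.
rewrite lam_Jmap tens_mul1l -mulrA lam2_KAl //; exact: C2_tens_mul.
Qed.

Lemma hatdeltaE w z : w \in Z -> z \in Z ->
  hatdelta H (hatcl lam w) (hatcl lam z) = vclass (C2Z H) (K2Z H lam) (delta H w z).
Proof.
apply: vmap2E => [u v Zu Zv|u v c Zu Zv Zc Kuv|u v c Zu Zv Zc Kuv]; first exact: delta_mem.
  have Zuv := KA_center Kuv.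
  apply/memK2Z; split=> [|t tC]; first by rewrite rpredB ?delta_mem.
  have -> : delta H u c - delta H v c = delta H (u - v) c.
    by rewrite /delta !(linB _ _ ((tprod_bilin A A).2 _)) mulrBl !opprD addrACA.
  rewrite muform_lam2 /delta mulrBl lam2B tens_mul1r -!mulrA !lam2_KAr ?subrr //.
    exact/C2M/tC/C2_comul.
  exact: C2_tens_mul.
have Zuv := KA_center Kuv.
apply/memK2Z; split=> [|t tC]; first by rewrite rpredB ?delta_mem.
have -> : delta H c u - delta H c v = delta H c (u - v).
  by rewrite /delta (linB _ _ ((tprod_bilin A A).1 _)) [Delta (u - v)]raddfB mulrBr !opprD addrACA.
rewrite muform_lam2 /delta mulrBl lam2B tens_mul1l -!mulrA lam2_KAl ?C2_tens_mul //.
by rewrite mulrA (center_comm_tens _ center1 Zc) -mulrA lam2_KA_comul ?C2_tens_mul ?subrr.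
Qed.

Lemma flip_conj_comulM a t :
  tflip (R * (Delta a * t) * R^-1) = Delta a * tflip (R * t * R^-1).
Proof.
by rewrite -[in RHS](flip_conj_comul a) -tflipM -conj_unitM ?Rmx_unit.
Qed.

(** Replacing t by the flip of R t R^-1 preserves C2 and, by [lam2_flip], exchanges (z ⊗ 1) Delta(z)
    with (1 ⊗ z) Delta(z) under F. *)
Lemma slidable_delta z : z \in Z ->
  reflect (slidable z) (delta H z z \in K2Z H lam).
Proof.
move=> Zz; have Z1 := center1; apply: (iffP (memK2Z _ _ _)) => [[_ d0] t tC|sz].
  have := d0 _ (C2_flip_conj tC); rewrite muform_lam2 /delta mulrBl lam2B => /eqP.
  rewrite subr_eq0 -(lam2_flip _ Zz Zz) -(mulrA (1 \ox z)) -flip_conj_comulM.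
  by rewrite -(lam2_flip _ Zz Z1) => /eqP.
split=> [|t tC]; first exact: delta_mem.
rewrite muform_lam2 /delta mulrBl lam2B; apply/eqP; rewrite subr_eq0; apply/eqP.
rewrite -(mulrA (1 \ox z)) lam2_flip // sz ?C2_flip_conj // -flip_conj_comulM.
by rewrite -(lam2_flip _ Z1 Zz).
Qed.

Lemma calTP z : z \in Z ->
  reflect (hatcl lam (S z) = hatcl lam z /\ slidable z) (hatcl lam z \in calT H lam).
Proof.
move=> Zz; rewrite !inE hatSE // hatdeltaE //.
have -> : (vclass (C2Z H) (K2Z H lam) (delta H z z) == 0) = (delta H z z \in K2Z H lam).
  have <- : vclass (C2Z H) (K2Z H lam) 0 = 0 by rewrite /vclass linear0 raddf0.
  by rewrite eq_vclass ?subr0 ?delta_mem ?mem0v.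
by apply: (iffP andP) => -[/eqP -> /(slidable_delta Zz)].
Qed.

(** * Units, products and stability of T *)

Lemma Lam_center : Lam \in Z.
Proof. by apply/centerP => a; rewrite intLam.1 intLam.2. Qed.

Lemma slidable1 : slidable 1.
Proof. by move=> t _; congr (lam2 (_ * _)); rewrite comul1 mul1r. Qed.

(** Already (Lam ⊗ 1) Delta(Lam) = Lam ⊗ Lam, from Lam a = eps(a) Lam. *)
Lemma slidable_Lam : slidable Lam.
Proof.
move=> t _; rewrite mulrA; congr (lam2 (_ * t)).
rewrite -{2}[Lam](counitl H) -[Delta Lam in RHS]tens_sum.
rewrite (lin_tsum (g := fun x : A \ox A => (Lam \ox 1) * x)); last by lin.
rewrite (lin_tsum (g := fun x => Lam \ox x)); last by lin.
apply: eq_tsum => a b; rewrite tprodM mul1r intLam.2.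
by rewrite (linear_scale ((tprod_bilin A A).1 _)) (linear_scale ((tprod_bilin A A).2 _)).
Qed.

(** Slide z on (w ⊗ w) t, then w on (z ⊗ 1) Delta(z) t. *)
Lemma slidableM z w : z \in Z -> w \in Z ->
  slidable z -> slidable w -> slidable (z * w).
Proof.
move=> Zz Zw sz sw t tC; have Z1 := center1.
have -> : (z * w) \ox (z * w) = (z \ox z) * (w \ox w) by rewrite tprodM.
have -> : (z * w) \ox (1 : A) = (w \ox 1) * (z \ox 1).
  by rewrite tprodM mulr1 (centerP _ Zz).
rewrite -(mulrA (z \ox z)) sz; last exact: C2_tens_mul.
have E x (y : A \ox A) : x * ((w \ox w) * y) = (w \ox w) * (x * y).
  by rewrite mulrA -(center_comm_tens _ Zw Zw) mulrA.
rewrite !E sw; last by apply: C2_tens_mul => //; apply: C2M => //; apply: C2_comul.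
rewrite (centerP _ Zz) rmorphM -(mulrA (w \ox 1)); congr (lam2 (_ * _)).
rewrite (mulrA (Delta w)) -(center_comm_tens (Delta w) Zz Z1) -(mulrA (z \ox 1)).
by rewrite !mulrA.
Qed.

(** Test against central c: [lam] is S-invariant there, and two uses of [lam2_comul_sym] exchange
    the arguments. *)
Lemma hat_antipode_star z w : z \in Z -> w \in Z ->
  hatcl lam (S (z ⋆ w)) = hatcl lam (S w ⋆ S z).
Proof.
move=> Zz Zw; have [ZSz ZSw] := (antipode_center Zz, antipode_center Zw).
have Zzw := star_center Zz Zw.
apply: hatcl_eq_lam => [||c Zc]; [exact: antipode_center|exact: star_center|].
have ZSc := antipode_center Zc; have Zcw := star_center Zc Zw.
rewrite -{1}(antipode_sqr_center Zc) -antipodeM lam_antipode_center ?centerM //.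
rewrite (centerP _ Zzw) lam_lam2_star lam2_comul_sym // -lam_lam2_star.
rewrite (centerP _ ZSz) lam_star_lam2 lam2_comul_sym // lam_lam2_star.
by rewrite antipode_sqr_center.
Qed.

(** F is invariant under S ⊗ S on C2, and S ⊗ S sends M to its flip. *)
Lemma hat_antipode_Jmap z : z \in Z ->
  hatcl lam (S (Jmap H lam z)) = hatcl lam (Jmap H lam (S z)).
Proof.
move=> Zz; have ZSz := antipode_center Zz; have ZJ := Jmap_center Zz.
apply: hatcl_eq_lam => [||c Zc]; [exact: antipode_center|exact: Jmap_center|].
have ZSc := antipode_center Zc.
rewrite -{1}(antipode_sqr_center Zc) -antipodeM lam_antipode_center ?centerM //.
rewrite (centerP _ ZJ) !lam_Jmap lam2_monodromy_sym //.
rewrite -lam2_antipode ?C2_tens_mul // lam2_tens_mul.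
rewrite tsum_mul ?tsumE; [|lin..].
under eq_tsum => p q do rewrite !antipodeM antipode_sqr_center //.
rewrite (sum_monodromy_antipode (f := fun p q => lam (p * c) * lam (q * S z))); last by lin.
apply: eq_tsum => p q; rewrite (centerP _ Zc) (centerP _ ZSz); exact: mulrC.
Qed.

Lemma calT_ex (x : hatZ lam) : x \in calT H lam ->
  exists z, [/\ z \in Z, x = hatcl lam z, hatcl lam (S z) = hatcl lam z & slidable z].
Proof. by have [z Zz ->] := hatcl_ex x => /(calTP Zz)[Sz sz]; exists z. Qed.

Lemma calT_mul : comm_monoid_on (calT H lam) (hatmul lam) (hatcl lam 1).
Proof.
split=> [|x y|x y u|x y|x].
- by apply/calTP => //; rewrite antipode1; split=> //; apply: slidable1.
- move=> /calT_ex[z [Zz -> Sz sz]] /calT_ex[w [Zw -> Sw sw]]; have Zzw := centerM Zz Zw.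
  rewrite hatmulE //; apply/calTP => //; split; last exact: slidableM.
  by rewrite antipodeM -!hatmulE ?antipode_center // Sz Sw !hatmulE // (centerP _ Zz).
- move=> /calT_ex[z [Zz -> _ _]] /calT_ex[w [Zw -> _ _]] /calT_ex[v [Zv -> _ _]].
  by rewrite !hatmulE ?centerM // mulrA.
- move=> /calT_ex[z [Zz -> _ _]] /calT_ex[w [Zw -> _ _]].
  by rewrite !hatmulE // (centerP _ Zz).
- by move=> /calT_ex[z [Zz -> _ _]]; rewrite hatmulE // mul1r.
Qed.

Lemma hatstarC z w : z \in Z -> w \in Z -> hatcl lam (z ⋆ w) = hatcl lam (w ⋆ z).
Proof.
move=> Zz Zw; apply: hatcl_eq_lam => [||c Zc]; try exact: star_center.
exact: lam_starC.
Qed.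

Lemma calT_star : comm_monoid_on (calT H lam) (hatstar H lam) (hatcl lam Lam).
Proof.
have ZL := Lam_center; have sZ := star_center.
split=> [|x y|x y u|x y|x].
- by apply/calTP => //; rewrite antipode_Lam; split=> //; apply: slidable_Lam.
- move=> /calT_ex[z [Zz -> Sz sz]] /calT_ex[w [Zw -> Sw sw]]; have Zzw := sZ _ _ Zz Zw.
  rewrite hatstarE //; apply/calTP => //; split; last exact: slidable_star.
  rewrite hat_antipode_star // -hatstarE ?antipode_center // Sz Sw hatstarE //.
  exact: hatstarC.
- move=> /calT_ex[z [Zz -> _ _]] /calT_ex[w [Zw -> _ _]] /calT_ex[v [Zv -> _ _]].
  by rewrite !hatstarE ?sZ // starA.
- move=> /calT_ex[z [Zz -> _ _]] /calT_ex[w [Zw -> _ _]].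
  by rewrite !hatstarE // hatstarC.
- by move=> /calT_ex[z [Zz -> _ _]]; rewrite hatstarE // star1l.
Qed.

Lemma calT_J : {in calT H lam, forall x, hatJ H lam x \in calT H lam}.
Proof.
move=> _ /calT_ex[z [Zz -> Sz sz]]; rewrite hatJE //; have Z1 := center1.
have [ZJ Zj] := (Jmap_center Zz, Jdual_center Zz).
have Jj : hatcl lam (Jmap H lam z) = hatcl lam (Jdual z).
  by apply: hatcl_eq_lam => // c Zc; rewrite lam_Jdual.
have SJ : hatcl lam (S (Jmap H lam z)) = hatcl lam (Jmap H lam z).
  by rewrite hat_antipode_Jmap // -hatJE ?antipode_center // Sz hatJE.
rewrite Jj; apply/calTP => //; split.
  by rewrite -hatSE // -Jj hatSE.
(* [Jdual_slide] has the factor (1 ⊗ j) Delta(j) of [delta], so the radical is tested directly. *)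
apply/slidable_delta => //; apply/memK2Z; split=> [|t tC]; first exact: delta_mem.
rewrite muform_lam2 /delta mulrBl lam2B -mulrA Jdual_slide // subrr //.
Qed.

End RibbonHopf.

Theorem lemma2p11 (k : fieldType) (A : falgType k) (H : ribbonHopfAlgebra A)
    (unimodH : unimodular H)
    (Lam : A) (intLam : two_sided_integral H Lam)
    (lam : 'Hom(A, k^o)) (intlam : dual_right_integral H lam)
    (lamLam : lam Lam = 1) :
  [/\ comm_monoid_on (calT H lam) (hatmul lam) (hatcl lam 1),
      comm_monoid_on (calT H lam) (hatstar H lam) (hatcl lam Lam) &
      {in calT H lam, forall x, hatJ H lam x \in calT H lam}].
Proof.
split; first exact: (calT_mul intLam intlam lamLam).
  exact: (calT_star intLam intlam lamLam).
exact: (calT_J intLam intlam lamLam).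
Qed.
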